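(* Let $\mu$ be a permuton and for each $n\in\mathbb{N}^*$ let $\sigma_n\sim\mathrm{Sample}_n(\mu)$. For each $k\in\mathbb{N}^*$, the function $\widetilde\lambda^\mu_k:[0,1]^2\to\mathbb{R}$ is nondecreasing and $1$-Lipschitz in each variable. Moreover, almost surely, the functions $$(x,y)\mapsto\frac1n\lambda_k^{\sigma_n}\big(\lfloor xn\rfloor,\lfloor yn\rfloor\big)$$ converge to $\widetilde\lambda_k^\mu$ uniformly on $[0,1]^2$ as $n\to\infty$.
   Context: $\mathbb{N}^*=\{1,2,\dots\}$. A permuton is a Borel probability measure on $[0,1]^2$ with both marginals uniform on $[0,1]$. Given points $Z_1,\dots,Z_n\in[0,1]^2$ with distinct $x$-coordinates and distinct $y$-coordinates, $\mathrm{Perm}(Z_1,\dots,Z_n)$ is the permutation $\sigma$ of $\{1,\dots,n\}$ with $\sigma(i)=j$ whenever the point with $i$-th lowest $x$-coordinate has $j$-th lowest $y$-coordinate. $\mathrm{Sample}_n(\mu)$ is the law of $\mathrm{Perm}(Z_1,\dots,Z_n)$ for $Z_1,\dots,Z_n$ i.i.d. with law $\mu$ (a.s. well defined). The $\sigma_n$ are defined on a common probability space. For a word $w=w_1\cdots w_m$ with distinct letters, an increasing subsequence is a set of indices $\{i_1<\dots<i_\ell\}$ with $w_{i_1}<\dots<w_{i_\ell}$; $\mathrm{LIS}_k(w):=\max|I_1\cup\dots\cup I_k|$ over families of $k$ increasing subsequences, and $\mathrm{LIS}_0(w):=0$. For a permutation $\sigma$ of size $n$ and $0\le i,j\le n$,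 $\sigma^{i,j}$ is the word formed by the letters $\sigma(h)$ with $h\le i$ and $\sigma(h)\le j$ (in order of $h$), and $\lambda_k^\sigma(i,j):=\mathrm{LIS}_k(\sigma^{i,j})-\mathrm{LIS}_{k-1}(\sigma^{i,j})$ (equal to $0$ if $\sigma^{i,j}$ is empty). A subset $A\subset[0,1]^2$ is nondecreasing if $(x_2-x_1)(y_2-y_1)\ge 0$ for all $(x_1,y_1),(x_2,y_2)\in A$, and $k$-nondecreasing if it is a union of $k$ nondecreasing subsets. For a finite Borel measure $\nu$ on $[0,1]^2$, $\widetilde{\mathrm{LIS}}_k(\nu):=\sup_A \nu(A)$ over closed $k$-nondecreasing $A\subset[0,1]^2$, $\widetilde{\mathrm{LIS}}_0(\nu):=0$. For $(x,y)\in[0,1]^2$, $\widetilde\lambda_k^\mu(x,y):=\widetilde{\mathrm{LIS}}_k(\mu|_{[0,x]\times[0,y]})-\widetilde{\mathrm{LIS}}_{k-1}(\mu|_{[0,x]\times[0,y]})$, where $\mu|_{[0,x]\times[0,y]}$ is the restriction of $\mu$ to $[0,x]\times[0,y]$ (not renormalized). *)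

(* Defs.v *)
From HB Require Import structures.
From mathcomp Require Export all_boot all_order all_algebra perm.
From mathcomp Require Export all_classical all_reals all_analysis.

Set Implicit Arguments.
Unset Strict Implicit.
Unset Printing Implicit Defensive.

Export Order.TTheory GRing.Theory Num.Theory.
Export numFieldNormedType.Exports.

Local Open Scope classical_set_scope.
Local Open Scope ring_scope.

Definition increasing_subseq (w : seq nat) (I : {set 'I_(size w)}) : bool :=
  [forall i in I, forall j in I, (i < j)%N ==> (nth 0%N w i < nth 0%N w j)%N].

(* For k = 0 the only family is the empty one, so LIS 0 w = 0. *)
Definition LIS (k : nat) (w : seq nat) : nat :=
  \max_(F : {ffun 'I_k -> {set 'I_(size w)}} |
        [forall a, increasing_subseq (F a)]) #|\bigcup_(a : 'I_k) F a|%SET.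

(* An index h : 'I_n stands for the integer h.+1 in {1, ..., n}, and likewise
   for the values of s. *)
Definition subword (n : nat) (s : 'S_n) (i j : nat) : seq nat :=
  [seq (s h).+1 | h : 'I_n <- enum 'I_n & (h.+1 <= i)%N && ((s h).+1 <= j)%N].

Definition lam (R : realType) (k n : nat) (s : 'S_n) (i j : nat) : R :=
  (LIS k (subword s i j))%:R - (LIS k.-1 (subword s i j))%:R.

Notation plane R := (measurableTypeR R * measurableTypeR R)%type.

Definition unit_square (R : realType) : set (R * R) := `[0, 1] `*` `[0, 1].
Arguments unit_square R : clear implicits.

(* The measure lives on the whole plane; uniform marginals force it to be
   carried by the unit square. *)
Definition permuton (R : realType) (mu : probability (plane R) R) : Prop :=
  forall A : set (measurableTypeR R), measurable A ->
    pushforward mu (fun z : plane R => z.1) A = uniform_prob (@ltr01 R) A /\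
    pushforward mu (fun z : plane R => z.2) A = uniform_prob (@ltr01 R) A.

Definition nondecreasing_set (R : realType) (A : set (R * R)) : Prop :=
  forall p q, A p -> A q -> 0 <= (q.1 - p.1) * (q.2 - p.2).

Definition k_nondecreasing_set (R : realType) (k : nat) (A : set (R * R)) :
    Prop :=
  exists F : 'I_k -> set (R * R),
    (forall a, nondecreasing_set (F a)) /\ A = \bigcup_a F a.

(* For k = 0 the only admissible set is empty, so tLIS 0 nu = 0. *)
Definition tLIS (R : realType) (k : nat)
    (nu : {finite_measure set (plane R) -> \bar R}) : R :=
  fine (ereal_sup [set nu A | A in [set A : set (R * R) |
    [/\ closed A, A `<=` unit_square R & k_nondecreasing_set k A]]]).

Definition corner (R : realType) (x y : R) : set (plane R) :=
  `[0, x] `*` `[0, y].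

Lemma measurable_corner (R : realType) (x y : R) : measurable (corner x y).
Proof. by apply: measurableX; exact: measurable_itv. Qed.

Lemma corner_lty (R : realType) (mu : probability (plane R) R) (x y : R) :
  (mu (corner x y) < +oo)%E.
Proof.
by rewrite (le_lt_trans (probability_le1 _ (measurable_corner _ _))) ?ltry.
Qed.

Definition restr_corner (R : realType) (mu : probability (plane R) R)
    (x y : R) : {finite_measure set (plane R) -> \bar R} :=
  mfrestr (measurable_corner x y) (corner_lty mu x y).

Definition tlam (R : realType) (mu : probability (plane R) R) (k : nat)
    (x y : R) : R :=
  tLIS k (restr_corner mu x y) - tLIS k.-1 (restr_corner mu x y).

(* Number of coordinates below the h-th one; when the coordinates are distinct,
   the h-th one is the (rank + 1)-th lowest. *)
Definition rank_of (R : realType) (n : nat) (f : 'I_n -> R) (h : 'I_n) : nat :=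
  #|[set a : 'I_n | f a < f h]%SET|.

Definition is_Perm (R : realType) (n : nat) (Z : 'I_n -> R * R) (s : 'S_n) :
    Prop :=
  [/\ injective (fun h => (Z h).1), injective (fun h => (Z h).2) &
    forall h i j : 'I_n,
      rank_of (fun h => (Z h).1) h = i ->
      rank_of (fun h => (Z h).2) h = j ->
      s i = j].

(* Independence is the product rule for every subfamily J. *)
Definition iid (R : realType) (d : measure_display) (T : measurableType d)
    (P : probability T R) (n : nat) (mu : probability (plane R) R)
    (Z : 'I_n -> T -> plane R) : Prop :=
  [/\ forall h, measurable_fun setT (Z h),
      forall h (A : set (plane R)), measurable A ->
        pushforward P (Z h) A = mu A &
      forall (J : {set 'I_n}) (A : 'I_n -> set (plane R)),
        (forall h, measurable (A h)) ->
        P (\bigcap_(h in [set` J]) (Z h @^-1` A h)) =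
        (\prod_(h in J) P (Z h @^-1` A h))%E].

(* s ~ Sample_n(mu): s is a random variable in the discrete space 'S_n with the
   law of Perm(Z_1, ..., Z_n), the Z_h being i.i.d. with law mu on some
   probability space (not necessarily the one on which s is defined). *)
Definition is_sample (R : realType) (d : measure_display)
    (T : measurableType d) (P : probability T R) (n : nat)
    (mu : probability (plane R) R) (s : T -> 'S_n) : Prop :=
  (forall t : 'S_n, measurable (s @^-1` [set t])) /\
  exists (d' : measure_display) (T' : measurableType d')
         (P' : probability T' R) (Z : 'I_n -> T' -> plane R),
    iid P' mu Z /\
    forall t : 'S_n,
      P (s @^-1` [set t]) = P' [set w | is_Perm (fun h => Z h w) t].

(* Main.v *)
Require Import Defs.
From mathcomp Require Import zify ring lra measurable_realfun.

(* For a finite set [D] of points let [G_k(D)] be the largest size of a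
   union of [k] chains.  Coding [k] disjoint chains as a permutation (equivalently,
   a flow of value [k]) and exchanging along an alternating walk shows
   [G_{k+1}(D) + G_k(D + a) <= G_{k+1}(D + a) + G_k(D)] for [a] maximal, so that
   [lambda_k] changes by 0 or 1 when one point is added on the right or on top.
   For fixed [(x, y)], [LIS_k / n] concentrates exponentially fast around the
   variational quantity [tLIS_k]: from below by counting the sample points of a
   nearly optimal closed set, from above because a union of [k] chains lies in a
   union of dyadic cells, of which there are finitely many at each scale, and
   compactness compares the mass of such cell unions with [tLIS_k].
   Borel-Cantelli gives almost sure convergence, without any assumption on the
   joint law of the permutations.  Monotonicity and the Lipschitz bound pass to
   the limit, and they upgrade convergence on grids to uniform convergence. *)

Set Implicit Arguments.
Unset Strict Implicit.
Unset Printing Implicit Defensive.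

(** * Unions of chains in a finite strict order *)

(** [tlam] is a difference of two suprema, which makes its monotonicity and its Lipschitz bound hard
    to reach directly. Both come from the discrete side. The exchange inequality says that
    [G_{k+1} - G_k] does not decrease when a maximal point is added; it grows by at most 1 because
    [G_{k+1}] gains at most one while [G_k] never decreases. A single outcome along which
    convergence holds hands these bounds to [tlam], so the analytic half of the theorem is deduced
    from the probabilistic half. A second obstacle is that corners of a permutation are cut by
    ranks, those of the permuton by coordinates. Uniform marginals make them differ by few points as
    soon as the counts in two strips are near their means. For fixed [(x, y)], [k] and precision,
    the whole comparison is deterministic given the counts of a finite list of sets that does not
    depend on [n], so a union bound keeps the exponential rate. *)

Section Greene.
Variables (T : finType) (r : rel T).
Implicit Types D E I J : {set T}.

Definition chain (I : {set T}) : bool :=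
  [forall x in I, forall y in I, (x != y) ==> (r x y || r y x)].

Definition chain_family (k : nat) (D : {set T}) (F : {ffun 'I_k -> {set T}}) :=
  [forall a, chain (F a) && (F a \subset D)].

Definition greene (k : nat) (D : {set T}) : nat :=
  (\max_(F : {ffun 'I_k -> {set T}} | chain_family D F) #|\bigcup_a F a|%SET)%N.

Lemma chainP (I : {set T}) :
  reflect {in I &, forall x y, x != y -> r x y || r y x} (chain I).
Proof.
apply: (iffP forall_inP) => [h x y xI yI xy|h x xI].
  by have /forall_inP/(_ y yI)/implyP := h x xI; apply.
by apply/forall_inP => y yI; apply/implyP; exact: h.
Qed.

Lemma chain_sub (I J : {set T}) : I \subset J -> chain J -> chain I.
Proof.
move=> /fintype.subsetP IJ /chainP h; apply/chainP => x y xI yI.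
by apply: h; exact: IJ.
Qed.

Lemma chain_set0 : chain finset.set0.
Proof. by apply/chainP => x y; rewrite finset.in_set0. Qed.

Lemma chain_familyP k (D : {set T}) (F : {ffun 'I_k -> {set T}}) :
  reflect (forall a, chain (F a) /\ F a \subset D) (chain_family D F).
Proof. by apply: (iffP forallP) => h a; have /andP := h a. Qed.

Lemma greene_ge k (D : {set T}) (F : 'I_k -> {set T}) :
  (forall a, chain (F a) /\ F a \subset D) ->
  (#|\bigcup_a F a|%SET <= greene k D)%N.
Proof.
move=> h; rewrite /greene.
have -> : (\bigcup_a F a)%SET = (\bigcup_a (finfun F) a)%SET.
  by apply: eq_bigr => a _; rewrite ffunE.
apply: (@leq_bigmax_cond _ _
  (fun G : {ffun 'I_k -> {set T}} => #|\bigcup_a G a|%SET)).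
by apply/chain_familyP => a; rewrite ffunE.
Qed.

Lemma greene_witness k D : exists F : 'I_k -> {set T},
  (forall a, chain (F a) /\ F a \subset D) /\
  greene k D = #|\bigcup_a F a|%SET.
Proof.
have h0 : (0 < #|[pred F | @chain_family k D F]|)%N.
  apply/card_gt0P; exists [ffun=> finset.set0]; apply/chain_familyP => a.
  by rewrite ffunE chain_set0 finset.sub0set.
have [F /chain_familyP hF E] := eq_bigmax_cond
  (fun F : {ffun 'I_k -> {set T}} => #|\bigcup_a F a|%SET) h0.
by exists F; split.
Qed.

Lemma greene_mono k (D E : {set T}) :
  D \subset E -> (greene k D <= greene k E)%N.
Proof.
move=> DE; have [F [hF ->]] := greene_witness k D.
by apply: greene_ge => a; have [? /fintype.subset_trans ->] := hF a.
Qed.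

(** Intersecting an optimal family for [E] with [D] keeps chains and loses only points of
    [E :\: D]. *)
Lemma greene_diff k (D E : {set T}) :
  (greene k E <= greene k D + #|E :\: D|)%N.
Proof.
have [F [hF ->]] := greene_witness k E.
pose G a := (F a :&: D)%SET.
have hG a : chain (G a) /\ G a \subset D.
  have [h _] := hF a; split; last exact: finset.subsetIr.
  by apply: chain_sub h; exact: finset.subsetIl.
apply: leq_trans (leq_add (greene_ge hG) (leqnn _)).
apply: leq_trans (leq_card_setU _ _); apply/subset_leq_card/fintype.subsetP => x.
case/bigcupP => a _ xF; rewrite finset.in_setU finset.in_setD.
have [_ /fintype.subsetP/(_ _ xF) ->] := hF a.
case: (boolP (x \in D)) => xD; last by rewrite orbT.
by apply/orP; left; apply/bigcupP; exists a => //; rewrite finset.in_setI xF xD.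
Qed.

Lemma greeneS_ge k D : (greene k D <= greene k.+1 D)%N.
Proof.
have [F [hF ->]] := greene_witness k D.
pose G (a : 'I_k.+1) := if unlift ord_max a is Some b then F b else finset.set0.
have hG a : chain (G a) /\ G a \subset D.
  rewrite /G; case: unliftP => [b _|_]; first exact: hF.
  by rewrite chain_set0 finset.sub0set.
apply: leq_trans (greene_ge hG); apply/subset_leq_card/bigcupsP => b _.
rewrite (_ : F b = G (lift ord_max b)); first exact: finset.bigcup_sup.
by rewrite /G liftK.
Qed.

End Greene.

(** The hypothesis says that [f] sends the complement of [S] off the image [g(S)], so gluing [g] on
    [S] to [f] elsewhere stays injective. *)
Lemma perm_patch (X : finType) (f g : {perm X}) (S : {set X}) :
  (forall u, (f u \in [set g v | v in S]%SET) = (u \in S)) ->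
  exists h : {perm X}, forall u, h u = if u \in S then g u else f u.
Proof.
move=> fS; have h_inj : injective (fun u => if u \in S then g u else f u).
  move=> u v; case: ifPn => uS; case: ifPn => vS.
  - exact: perm_inj.
  - move=> E; move: vS; rewrite -fS -E => /negP[]; exact: imset_f.
  - move=> E; move: uS; rewrite -fS E => /negP[]; exact: imset_f.
  - exact: perm_inj.
by exists (perm h_inj) => u; rewrite permE.
Qed.

(** * Permutations that encode disjoint chains, and their exchange *)

Section PathSystems.
Variables (T : finType) (r : rel T).
Hypotheses (r_irr : irreflexive r) (r_tr : transitive r).
Variable K : nat.
Implicit Types (p f g : {perm (T + 'I_K)}) (D : {set T}) (u v : T + 'I_K).

(* A permutation of [T + 'I_K] encodes [k] disjoint chains: a chain
   [x_1 < ... < x_l] with label [j] is the cycle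
   [inr j -> inl x_1 -> ... -> inl x_l -> inr j], and the unused points of [T]
   and unused labels are fixed. *)
Definition path_system (k : nat) D p : Prop :=
  [/\ forall j : 'I_K, (k <= j)%N -> p (inr j) = inr j,
      forall x, x \notin D -> p (inl x) = inl x &
      forall x y, p (inl x) = inl y -> x = y \/ r x y].

Definition covered p : {set T} := [set x | p (inl x) != inl x]%SET.

Let is_inl u := if u is inl _ then true else false.

Lemma path_system_iter k D p x y m : path_system k D p ->
  (forall i, (i < m)%N -> is_inl (iter i p (inl x))) ->
  iter m p (inl x) = inl y -> x = y \/ r x y.
Proof.
move=> [_ _ hp]; elim: m y => [|m IH] y hm /=; first by case=> ->; left.
have := hm m (ltnSn m); case E : (iter m p (inl x)) => [z|//] _ /hp zy.
have {IH} := IH z (fun i im => hm i (ltnW im)) E.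
case: zy => [<-//|rzy] [->|rxz]; right => //; exact: r_tr rzy.
Qed.

(** Covered points are sorted by the first label their orbit meets. Orbits inside [T] increase, so
    points with the same first label form a chain, and at most [k] labels occur. *)
Lemma path_system_covered k D p : path_system k D p ->
  (#|covered p| <= greene r k D)%N.
Proof.
move=> hp; have [p_fix p_out p_ord] := hp.
pose F (j : 'I_k) : {set T} := [set x | (x \in covered p) &&
  `[< exists m, (exists2 j' : 'I_K, val j' = val j & iter m p (inl x) = inr j')
      /\ forall i, (i < m)%N -> is_inl (iter i p (inl x)) >]]%SET.
have hF j : chain r (F j) /\ F j \subset D.
  split; last first.
    apply/fintype.subsetP => x; rewrite !inE => /andP[xp _].
    by apply/negPn/negP => /p_out h; rewrite h eqxx in xp.
  apply/chainP => x y; rewrite !inE.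
  move=> /andP[_ /asboolP[m [[j1 jE1 xm] xi]]].
  move=> /andP[_ /asboolP[n [[j2 jE2 yn] yi]]].
  have {jE1 jE2} j12 : j1 = j2 by apply: val_inj; rewrite jE1.
  rewrite -{}j12 in yn.
  wlog mn : x y m n xm xi yn yi / (m <= n)%N.
    move=> W; case/orP: (leq_total m n) => [|/W]; first exact: W.
    by rewrite orbC eq_sym; apply.
  (* Both orbits reach the same label, after [m] and [n] steps; cancelling [m] steps by injectivity
     puts [x] on the orbit of [y]. *)
  have E : iter (n - m) p (inl y) = inl x.
    have it_inj : injective (iter m p).
      by elim: {+}m => [//|q IH] u v /= /perm_inj/IH.
    by apply: it_inj; rewrite -iterD subnKC// xm.
  have [] := path_system_iter hp _ E => [i ilt|->|->].
  - by apply: yi; exact: leq_trans ilt (leq_subr _ _).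
  - by rewrite eqxx.
  - by rewrite orbT.
apply: leq_trans (greene_ge hF); apply/subset_leq_card/fintype.subsetP => x xp.
(* Otherwise the cycle of [x] stays in [T]: [x] is strictly below its image, which is weakly below
   [x], against irreflexivity. *)
have [m0 hm0] : exists m, ~~ is_inl (iter m p (inl x)).
  apply/not_existsP => hall.
  have hin i : is_inl (iter i p (inl x)) by apply/negPn/negP/hall.
  have := hin 1%N; rewrite /=; case E1 : (p (inl x)) => [y|//] _.
  have xy : r x y.
    have [xy|//] := p_ord _ _ E1; move: xp.
    by rewrite inE E1 xy eqxx.
  have := iter_order (@perm_inj _ p) (inl x); rewrite /= -orderSpred iterSr E1 => E.
  have [|yx|yx] := path_system_iter hp _ E.
  - by move=> i _; rewrite -E1 -iterSr; exact: hin.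
  - by rewrite yx r_irr in xy.
  - by have := r_tr xy yx; rewrite r_irr.
case: (ex_minnP (ex_intro (fun m => ~~ is_inl (iter m p (inl x))) m0 hm0)).
move=> m hm mmin.
case E : (iter m p (inl x)) hm => [//|j] _.
(* Labels from [k] on are fixed points, so no orbit coming from [T] can reach them. *)
have jk : (j < k)%N.
  rewrite ltnNge; apply/negP => /p_fix pj.
  have : iter m p (inl x) = iter m p (inr j).
    by rewrite E; elim: {+}m => [//|q IH] /=; rewrite -IH pj.
  have it_inj : injective (iter m p).
    by elim: {+}m => [//|q IH] u v /= /perm_inj/IH.
  by move=> /it_inj.
apply/bigcupP; exists (Ordinal jk) => //; rewrite inE xp/=; apply/asboolP.
exists m; split; first by exists j.
by move=> i im; apply/negPn/negP => /mmin; rewrite leqNgt im.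
Qed.

(** Overlaps of an optimal family are removed by colouring each point with one chain containing it.
    Each colour class is sorted and preceded by its label, and [next] on this cyclic list is the
    permutation. *)
Lemma path_system_exists k D : (k <= K)%N ->
  exists2 p, path_system k D p & (greene r k D <= #|covered p|)%N.
Proof.
move=> kK; have [F [hF ->]] := greene_witness r k D.
pose c (x : T) : option 'I_k := [pick j | x \in F j].
pose w := widen_ord kK.
(* Labels from [k] on get no colour, hence are fixed by [pf]. *)
pose col u : option 'I_k :=
  match u with inl x => c x | inr j => insub (val j) end.
(* Sorting requires totality, which holds for the reflexive closure on a chain; as the list has no
   repetition, [r] is recovered afterwards. *)
pose r' x y := (x == y) || r x y.
pose s j := sort r' (enum [pred x | c x == Some j]).
pose l j : seq (T + 'I_K) := inr (w j) :: map inl (s j).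
have r'_tr : transitive r'.
  move=> y x z /orP[/eqP->//|xy] /orP[/eqP<-|yz]; rewrite /r' ?xy ?orbT//.
  by rewrite (r_tr xy yz) orbT.
have s_mem j x : (x \in s j) = (c x == Some j) by rewrite mem_sort mem_enum inE.
have c_in j x : c x = Some j -> x \in F j.
  by rewrite /c; case: pickP => // j' ? [<-].
have s_uniq j : uniq (s j) by rewrite sort_uniq enum_uniq.
have s_sorted j : sorted r (s j).
  apply: pairwise_sorted.
  have : pairwise [rel x y | r' x y && (x != y)] (s j).
    rewrite pairwise_relI -uniq_pairwise s_uniq andbT -sorted_pairwise//.
    apply: (@sort_sorted_in _ (mem (F j))); last first.
      by apply/allP => x; rewrite mem_enum inE => /eqP/c_in.
    move=> x y xF yF; rewrite /r' (eq_sym y).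
    case: eqVneq => //= xy.
    by have [/chainP h _] := hF j; apply: h.
  apply: sub_pairwise => x y /=.
  by rewrite /r'; case: eqVneq => //= _; rewrite andbT.
have l_uniq j : uniq (l j).
  rewrite /= map_inj_uniq ?s_uniq ?andbT; last by move=> ? ? [].
  by apply/negP => /mapP[].
have l_col u j : (u \in l j) = (col u == Some j).
  rewrite inE; case: u => [x|i] /=.
    by rewrite mem_map ?s_mem//; move=> ? ? [].
  have -> : (inr i \in map (@inl T 'I_K) (s j)) = false by apply/negP => /mapP[].
  rewrite orbF; case: insubP => [i' ik' E|ik'].
    apply/eqP/eqP => [[ij]|[<-]]; first by congr Some; apply: val_inj; rewrite E ij.
    by congr inr; apply: val_inj; rewrite /= -E.
  apply/negbTE/negP => /eqP[ij]; move: ik'.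
  by rewrite ij/= ltn_ord.
pose pf u := if col u is Some j then next (l j) u else u.
have col_pf u : col (pf u) = col u.
  rewrite /pf; case E : (col u) => [j|//]; apply/eqP.
  by rewrite -l_col mem_next l_col E.
have pf_inj : injective pf.
  move=> u v uv; have : col u = col v by rewrite -col_pf uv col_pf.
  move: uv; rewrite /pf => + cE; rewrite cE; case: (col v) => [j|//].
  by move=> /(congr1 (prev (l j))); rewrite !prev_next.
(* Steps to or from a label carry no order condition. An empty colour class leaves a loop at the
   label, which [e] rejects; hence the nonemptiness condition in [l_cycle]. *)
pose e u v := match u, v with inl x, inl y => r x y | _, _ => u != v end.
have l_cycle j : s j != [::] -> cycle e (l j).
  have path_e x t : path r x t -> path e (inl x) (rcons (map inl t) (inr (w j))).
    by elim: t x => [//|y t IH] x /= /andP[-> /IH].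
  rewrite /l; have := s_sorted j; case: (s j) => [//|x t] /= xt _.
  exact: path_e.
have pf_next j x : c x = Some j -> e (inl x) (pf (inl x)).
  move=> cx; have -> : pf (inl x) = next (l j) (inl x) by rewrite /pf /= cx.
  apply: (@next_cycle _ e (l j)); last first.
    by rewrite l_col /= cx.
  by apply: l_cycle; apply/eqP => s0; have := s_mem j x; rewrite s0 cx eqxx.
exists (perm pf_inj); last first.
  apply/subset_leq_card/fintype.subsetP => x /bigcupP[j _ xj].
  rewrite inE permE; case E : (c x) => [j'|]; last first.
    by move: E; rewrite /c; case: pickP => // /(_ j); rewrite xj.
  have := pf_next _ _ E; apply: contraTneq => -> /=.
  by rewrite r_irr.
split=> [j kj|x xD|x y].
- by rewrite permE /pf /= insubF// ltnNge kj.
- rewrite permE /pf /=; case E : (c x) => [j|//].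
  have [_ /fintype.subsetP/(_ _ (c_in _ _ E))] := hF j.
  by rewrite (negbTE xD).
- rewrite permE; case E : (c x) => [j|]; last first.
    by rewrite /pf /= E => -[]; left.
  by move=> pE; have := pf_next _ _ E; rewrite pE /=; right.
Qed.


(* The alternating walk [u_0 = a, u_{i+1} = g^-1 (f u_i)] is followed until [f]
   leads to a label; after relabelling the ends of the chains of [f] it closes
   up, and [f] and [g] can be exchanged along it. *)
Lemma path_system_exchange k D a f g : K = k.+1 -> a \notin D ->
  (forall x, x \in D -> ~~ r a x) ->
  path_system k.+1 D f -> path_system k (a |: D)%SET g ->
  exists f' g', [/\ path_system k.+1 (a |: D)%SET f', path_system k D g' &
    (#|covered f'| + #|covered g'| = #|covered f| + #|covered g|)%N].
Proof.
move=> EK aD a_max hf hg.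
(* If [g] does not use [a], it is already a system for [D], and [f] is one for the larger set. *)
have [ga|ga] := eqVneq (g (inl a)) (inl a).
  exists f, g; split=> //.
    by case: hf => h1 h2 h3; split=> // x; rewrite !inE negb_or => /andP[_ /h2].
  case: hg => h1 h2 h3; split=> // x xD; have [->//|xa] := eqVneq x a.
  by apply: h2; rewrite !inE negb_or xa.
have [f_fix f_out f_ord] := hf; have [g_fix g_out g_ord] := hg.
(* Maximality of [a] excludes a successor in [D]: in [g], the point [a] ends its chain and leads to
   a label [t0]. *)
case gaE : (g (inl a)) => [y|t0].
  have ya : y != a by apply: contraNneq ga => ya; rewrite gaE ya.
  have yD : y \in D.
    apply/negPn/negP => yD.
    have /g_out gy : y \notin (a |: D)%SET by rewrite !inE negb_or ya.
    by move: gaE; rewrite -gy => /perm_inj[/esym/eqP]; rewrite (negbTE ya).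
  by have [/esym/eqP|] := g_ord _ _ gaE; rewrite ?(negbTE ya)// (negbTE (a_max _ yD)).
have t0k : (t0 < k)%N.
  by rewrite ltnNge; apply/negP => /g_fix E; move: gaE; rewrite -E => /perm_inj.
pose h : {perm (T + 'I_K)} := (f * g^-1)%g.
have hE u : g (h u) = f u by rewrite permM permKV.
(* The orbit of [a] under [h] is a cycle, and at the predecessor [u] of [a] one has [f u = g a], a
   label. So the walk stops. *)
have [m0 hm0] : exists m, ~~ is_inl (f (iter m h (inl a))).
  exists (order h (inl a)).-1.
  by rewrite -hE -iterS orderSpred iter_order; [rewrite gaE|exact: perm_inj].
case: (ex_minnP (ex_intro (fun m => ~~ is_inl (f (iter m h (inl a)))) m0 hm0)).
move=> m hm mmin.
have {hm}[t fmE] : exists t, f (iter m h (inl a)) = inr t.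
  by move: hm; case: (f _) => [//|t] _; exists t.
have f_inl i : (i < m)%N -> is_inl (f (iter i h (inl a))).
  by move=> im; apply/negPn/negP => /mmin; rewrite leqNgt im.
(* Swapping the labels [t] and [t0] among the values of [f] makes the last step of the walk lead to
   [t0], the label where [g] sends [a]. It alters no step between points of [T]. *)
pose f1 : {perm (T + 'I_K)} := (f * tperm (inr t) (inr t0))%g.
have f1E u : f1 u = tperm (inr t) (inr t0) (f u) by rewrite permM.
have f1_inl u : is_inl (f u) -> f1 u = f u.
  by rewrite f1E; case: (f u) => // x _; rewrite tpermD.
have f1_inl' u x : f1 u = inl x -> f u = inl x.
  move=> E; rewrite -[f u](tpermK (inr t) (inr t0)) -f1E E.
  by rewrite tpermD.
pose S : {set T + 'I_K} := [set iter (val i) h (inl a) | i : 'I_m.+1]%SET.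
(* Along the walk [g u_{i+1} = f1 u_i], and [g u_0 = inr t0 = f1 u_m] closes it up. *)
have gS : [set g u | u in S]%SET = [set f1 u | u in S]%SET.
  apply/eqP; rewrite eqEcard (card_imset _ (@perm_inj _ g)).
  rewrite (card_imset _ (@perm_inj _ f1)) leqnn andbT.
  apply/fintype.subsetP => _ /imsetP[_ /imsetP[[i im] _ ->] ->] /=.
  case: i im => [|i] im /=.
    rewrite gaE; apply/imsetP; exists (iter m h (inl a)).
      by apply/imsetP; exists ord_max.
    by rewrite f1E fmE tpermL.
  rewrite hE -f1_inl; last exact: f_inl.
  by apply: imset_f; apply/imsetP; exists (Ordinal (ltnW im)).
have aS : inl a \in S by apply/imsetP; exists ord0.
(* The spare label is fixed by [g], so the walk avoids it and [g'] still fixes it. On the other side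
   [K = k.+1], so [f'] has no label to fix. *)
have specS (j : 'I_K) : (k <= j)%N -> inr j \notin S.
  move=> kj; apply/negP => /imsetP[[[//|i] im] _ /= E].
  by have := f_inl i im; rewrite -hE -E g_fix.
have [f' f'E] : exists f' : {perm (T + 'I_K)},
    forall u, f' u = if u \in S then g u else f1 u.
  by apply: (@perm_patch _ f1 g S) => u; rewrite gS mem_imset//; exact: perm_inj.
have [g' g'E] : exists g' : {perm (T + 'I_K)},
    forall u, g' u = if u \in S then f1 u else g u.
  by apply: (@perm_patch _ g f1 S) => u; rewrite -gS mem_imset//; exact: perm_inj.
have f1_fix x : (f1 (inl x) == inl x) = (f (inl x) == inl x).
  by apply/eqP/eqP => [/f1_inl'//|E]; rewrite f1_inl E.
exists f', g'; split.
- split=> [j|x|x y].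
  + by rewrite leqNgt -EK ltn_ord.
  + rewrite f'E => xD; case: ifP => _; first exact: g_out.
    apply/eqP; rewrite f1_fix f_out//; apply: contra xD => xD.
    by rewrite !inE xD orbT.
  + rewrite f'E; case: ifP => _; first exact: g_ord.
    by move/f1_inl'; exact: f_ord.
- split=> [j kj|x xD|x y].
  + by rewrite g'E (negbTE (specS _ kj)) g_fix.
  + rewrite g'E; case: ifPn => xS; first by apply/eqP; rewrite f1_fix f_out.
    apply: g_out; rewrite !inE negb_or xD andbT.
    by apply: contraNneq xS => ->.
  + rewrite g'E; case: ifP => _; last exact: g_ord.
    by move/f1_inl'; exact: f_ord.
(* At each point the pair of values of [f'] and [g'] is that of [f1] and [g] up to order, so the
   total count is preserved term by term. *)
- have covE p : #|covered p| = (\sum_x (p (inl x) != inl x))%N.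
    rewrite -sum1_card [RHS]big_mkcond/= big_mkcond /=; apply: eq_bigr => x _.
    by rewrite inE; case: ifP.
  rewrite !covE -!big_split; apply: eq_bigr => x _ /=; rewrite f'E g'E -f1_fix.
  by case: ifP => _ //; rewrite addnC.
Qed.

End PathSystems.

(** * Effect of adding a maximal point *)

Section GreeneIncrements.
Variables (T : finType) (r : rel T).
Hypotheses (r_irr : irreflexive r) (r_tr : transitive r).
Variables (D : {set T}) (a : T).
Hypothesis a_max : forall x, x \in D -> ~~ r a x.

(** Both optima are coded over the same labels ['I_k.+1], one of them being idle in the system with
    [k] chains; this is the spare label of the exchange. *)
Lemma greene_exchange k :
  (greene r k.+1 D + greene r k (a |: D)%SET <=
   greene r k.+1 (a |: D)%SET + greene r k D)%N.
Proof.
have [aD|aD] := boolP (a \in D); first by rewrite (finset.setUidPr _) ?finset.sub1set.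
have [f hf fD] := path_system_exists r_irr r_tr D (leqnn k.+1).
have [g hg gD] := path_system_exists r_irr r_tr (a |: D)%SET (leqnSn k).
have [f' [g' [hf' hg' E]]] := path_system_exchange erefl aD a_max hf hg.
apply: leq_trans (leq_add fD gD) _; rewrite -E.
by apply: leq_add; exact: path_system_covered.
Qed.

Lemma greene_setU1 k :
  (greene r k D <= greene r k (a |: D)%SET <= (greene r k D).+1)%N.
Proof.
rewrite greene_mono ?finset.subsetUr//=.
apply: leq_trans (greene_diff r k D _) _; rewrite -addn1 leq_add2l.
rewrite finset.setDUl finset.setDv finset.setU0.
by apply: leq_trans (subset_leq_card (finset.subsetDl _ _)) _; rewrite cards1.
Qed.

(** Row [k.+1] of the Greene shape, indexed from 0; the truncated subtraction is exact by
    [greeneS_ge]. *)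
Definition greene_row k E := (greene r k.+1 E - greene r k E)%N.

Lemma greene_row_setU1 k :
  (greene_row k D <= greene_row k (a |: D)%SET <= (greene_row k D).+1)%N.
Proof.
have := greene_exchange k; have := greene_setU1 k; have := greene_setU1 k.+1.
have := greeneS_ge r k D; have := greeneS_ge r k (a |: D)%SET.
rewrite /greene_row; lia.
Qed.

End GreeneIncrements.

(** * Longest increasing subsequences as unions of chains *)

Section Transport.
Variables (T1 T2 : finType) (r1 : rel T1) (r2 : rel T2) (e : T1 -> T2).
Variables (D1 : {set T1}) (D2 : {set T2}).
(** The transport is used twice: from positions in a word to indices of the permutation, and from
    sample points to their ranks. *)
Hypothesis e_inj : {in D1 &, injective e}.
Hypothesis e_img : D2 = [set e x | x in D1]%SET.
Hypothesis e_rel : {in D1 &, forall x y, r2 (e x) (e y) = r1 x y}.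

Lemma greene_transport k : greene r1 k D1 = greene r2 k D2.
Proof.
apply/eqP; rewrite eqn_leq; apply/andP; split.
  have [F [hF ->]] := greene_witness r1 k D1.
  have hG a : chain r2 (e @: F a)%SET /\ (e @: F a)%SET \subset D2.
    have [/chainP hc /fintype.subsetP hs] := hF a.
    split; last by rewrite e_img; apply: imsetS; apply/fintype.subsetP.
    apply/chainP => _ _ /imsetP[x xF ->] /imsetP[y yF ->] exy.
    rewrite !e_rel ?hs//; apply: hc => //.
    by apply: contraNneq exy => ->.
  apply: leq_trans (greene_ge hG).
  rewrite -(@card_in_imset _ _ e); last first.
    move=> x y /bigcupP[a _ xa] /bigcupP[b _ yb].
    have [_ /fintype.subsetP ha] := hF a; have [_ /fintype.subsetP hb] := hF b.
    by apply: e_inj; [exact: ha|exact: hb].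
  apply/subset_leq_card/fintype.subsetP => _ /imsetP[x /bigcupP[a _ xa] ->].
  by apply/bigcupP; exists a => //; exact: imset_f.
have [F [hF ->]] := greene_witness r2 k D2.
pose G a : {set T1} := [set x in D1 | e x \in F a]%SET.
have hG a : chain r1 (G a) /\ G a \subset D1.
  have [/chainP hc /fintype.subsetP hs] := hF a.
  split; last by apply/fintype.subsetP => x; rewrite !inE => /andP[].
  apply/chainP => x y; rewrite !inE => /andP[xD xF] /andP[yD yF] xy.
  rewrite -!e_rel//; apply: hc => //.
  by apply: contraNneq xy => /e_inj ->.
apply: leq_trans (greene_ge hG).
apply: leq_trans (leq_imset_card e _).
apply/subset_leq_card/fintype.subsetP => y /bigcupP[a _ ya].
have [_ /fintype.subsetP/(_ _ ya)] := hF a.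
rewrite e_img => /imsetP[x xD yE]; rewrite yE; apply: imset_f.
by apply/bigcupP; exists a => //; rewrite !inE xD -yE.
Qed.

End Transport.

Lemma LIS_greene k (w : seq nat) :
  LIS k w = greene (fun i j : 'I_(size w) => (i < j)%N &&
    (nth 0%N w i < nth 0%N w j)%N) k finset.setT.
Proof.
apply: eq_bigl => F; apply: eq_forallb => a; rewrite finset.subsetT andbT.
apply/forall_inP/chainP => [h x y xF yF xy|h x xF].
  have /forall_inP/(_ y yF)/implyP hxy := h x xF.
  have /forall_inP/(_ x xF)/implyP hyx := h y yF.
  have : (x < y)%N || (y < x)%N by rewrite -neq_ltn.
  by case/orP => l; [rewrite l hxy|rewrite l hyx ?orbT].
apply/forall_inP => y yF; apply/implyP => xy.
have yx : (y < x)%N = false by rewrite ltnNge (ltnW xy).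
have := h x y xF yF; rewrite xy yx /= orbF; apply.
by rewrite -val_eqE ltn_eqF.
Qed.

(** * Corners of a permutation and growth of their rows *)

Section PermutationWords.
Variables (n : nat) (s : 'S_n).

Definition perm_rel (h h' : 'I_n) : bool := (h < h')%N && (s h < s h')%N.

(** Indices and values start at 0 here, so the strict bounds match [h.+1 <= i] and [(s h).+1 <= j]
    in [subword]. *)
Definition perm_corner (i j : nat) : {set 'I_n} :=
  [set h : 'I_n | (h < i)%N && (s h < j)%N]%SET.

Lemma perm_rel_irr : irreflexive perm_rel.
Proof. by move=> h; rewrite /perm_rel ltnn. Qed.

Lemma perm_rel_trans : transitive perm_rel.
Proof.
move=> b a c /andP[h1 h2] /andP[h3 h4].
by apply/andP; split; [exact: ltn_trans h3|exact: ltn_trans h4].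
Qed.

Lemma LIS_subword k i j :
  LIS k (subword s i j) = greene perm_rel k (perm_corner i j).
Proof.
rewrite LIS_greene; set w := subword s i j.
pose l := [seq h : 'I_n <- enum 'I_n | (h.+1 <= i)%N && ((s h).+1 <= j)%N].
have wE : w = [seq (s h).+1 | h <- l] by [].
have szw : size w = size l by rewrite wE size_map.
pose e (q : 'I_(size w)) : 'I_n := tnth (in_tuple l) (cast_ord szw q).
have eE x0 q : e q = nth x0 l q by rewrite /e (tnth_nth x0).
have l_uniq : uniq l by rewrite filter_uniq// enum_uniq.
have l_sorted : sorted ltn (map val l).
  apply: (@subseq_sorted _ ltn ltn_trans _ (map val (enum 'I_n))).
    by apply: map_subseq; exact: filter_subseq.
  by rewrite val_enum_ord iota_ltn_sorted.
have e_homo (q q' : 'I_(size w)) : (q < q')%N -> (e q < e q')%N.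
  have x0 := e q; rewrite !(eE x0) => qq'.
  have ql : (q < size l)%N by rewrite -szw.
  have ql' : (q' < size l)%N by rewrite -szw.
  rewrite -!(nth_map x0 (val x0) val)//.
  by apply: (sorted_ltn_nth ltn_trans); rewrite ?inE ?size_map.
have e_lt (q q' : 'I_(size w)) : (e q < e q')%N = (q < q')%N.
  apply/idP/idP; last exact: e_homo.
  case: (ltngtP q q') => // [/e_homo|/val_inj ->]; last by rewrite ltnn.
  by case: ltngtP.
apply: (@greene_transport _ _ _ _ e).
- move=> q q' _ _ /eqP; rewrite (eE (e q)) (eE (e q) q') nth_uniq -?szw//.
  by move/eqP/val_inj.
- apply/setP => h; rewrite !inE; apply/idP/imsetP => [hD|[q _ ->]].
    have hl : h \in l by rewrite mem_filter hD mem_enum.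
    have il : (index h l < size w)%N by rewrite szw index_mem.
    by exists (Ordinal il) => //; rewrite (eE h) nth_index.
  have : e q \in l by exact: mem_tnth.
  by rewrite mem_filter => /andP[].
- move=> q q' _ _; rewrite /perm_rel e_lt; congr andb.
  have wq (p : 'I_(size w)) : nth 0%N w p = (s (e p)).+1.
    have pl : (p < size l)%N by rewrite -szw.
    by rewrite [X in nth _ X]wE (nth_map (e p))// -eE.
  by rewrite !wq ltnS.
Qed.

(** The only candidate is index [i], to the right of the whole corner and hence maximal. Nothing is
    added if its value is too high or if [i >= n]. On the other side, the candidate is the point of
    value [j]. *)
Lemma perm_cornerSl i j : perm_corner i.+1 j = perm_corner i j \/
  exists a, (forall x, x \in perm_corner i j -> ~~ perm_rel a x) /\
            perm_corner i.+1 j = (a |: perm_corner i j)%SET.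
Proof.
have [ilt|ni] := ltnP i n; last first.
  left; apply/setP => h; rewrite !inE; congr andb.
  by have := ltn_ord h; lia.
pose a := Ordinal ilt; have [sa|sa] := ltnP (s a) j.
  right; exists a; split.
    move=> x; rewrite inE /perm_rel /= => /andP[xi _].
    by apply/negP => /andP[]; lia.
  apply/setP => h; rewrite !inE; case: eqVneq => [->|ha] /=.
    by rewrite ltnSn sa.
  have {}ha : (h != i :> nat) by apply: contraNneq ha => hi; apply/eqP/val_inj.
  by congr andb; lia.
left; apply/setP => h; rewrite !inE; case: (eqVneq h a) => [->|ha].
  by rewrite [(s a < j)%N]ltnNge sa !andbF.
have {}ha : (h != i :> nat) by apply: contraNneq ha => hi; apply/eqP/val_inj.
by congr andb; lia.
Qed.

Lemma perm_cornerSr i j : perm_corner i j.+1 = perm_corner i j \/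
  exists a, (forall x, x \in perm_corner i j -> ~~ perm_rel a x) /\
            perm_corner i j.+1 = (a |: perm_corner i j)%SET.
Proof.
have [jlt|nj] := ltnP j n; last first.
  left; apply/setP => h; rewrite !inE; congr andb.
  by have := ltn_ord (s h); lia.
pose a := (s^-1)%g (Ordinal jlt).
have sa : s a = j :> nat by rewrite permKV.
have sh h : h != a -> s h != j :> nat.
  apply: contraNneq => shj; apply/eqP/(@perm_inj _ s)/val_inj.
  by rewrite /= sa shj.
have [ai|ai] := ltnP a i.
  right; exists a; split.
    move=> x; rewrite inE /perm_rel /= => /andP[_ xj].
    by apply/negP => /andP[]; lia.
  apply/setP => h; rewrite !inE; case: eqVneq => [->|/sh ha] /=.
    by rewrite ai; lia.
  by congr andb; lia.
left; apply/setP => h; rewrite !inE; case: (eqVneq h a) => [->|/sh ha].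
  by rewrite [(a < i)%N]ltnNge ai.
by congr andb; lia.
Qed.

Definition perm_row k i j := greene_row perm_rel k (perm_corner i j).

Lemma perm_rowSl k i j : (perm_row k i j <= perm_row k i.+1 j <= (perm_row k i j).+1)%N.
Proof.
rewrite /perm_row; case: (perm_cornerSl i j) => [->|[a [a_max ->]]].
  by rewrite leqnn leqnSn.
exact: (greene_row_setU1 perm_rel_irr perm_rel_trans).
Qed.

Lemma perm_rowSr k i j : (perm_row k i j <= perm_row k i j.+1 <= (perm_row k i j).+1)%N.
Proof.
rewrite /perm_row; case: (perm_cornerSr i j) => [->|[a [a_max ->]]].
  by rewrite leqnn leqnSn.
exact: (greene_row_setU1 perm_rel_irr perm_rel_trans).
Qed.

End PermutationWords.

Local Open Scope ring_scope.

Section LamIncrements.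
Variables (R : realType) (n : nat) (s : 'S_n).

Lemma lam_perm_row k i j : (0 < k)%N -> lam R k s i j = (perm_row s k.-1 i j)%:R.
Proof.
case: k => // k _; rewrite /lam !LIS_subword /perm_row /greene_row.
by rewrite natrB// greeneS_ge.
Qed.

Lemma unit_steps (f : nat -> nat) : (forall i, (f i <= f i.+1 <= (f i).+1)%N) ->
  forall i i', (i <= i')%N -> (f i <= f i' <= f i + (i' - i))%N.
Proof.
move=> hf i i' /subnK <-; elim: (i' - i)%N => [|m IH].
  by rewrite add0n subnn addn0 leqnn.
have := hf (m + i)%N; move: IH; rewrite addSn; lia.
Qed.

Lemma lam_incrl k i i' j : (0 < k)%N -> (i <= i')%N ->
  lam R k s i j <= lam R k s i' j <= lam R k s i j + (i'%:R - i%:R).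
Proof.
move=> k0 ii'; rewrite !lam_perm_row// -natrB// -natrD !ler_nat.
by apply: (@unit_steps (fun i => perm_row s k.-1 i j)) => // m; exact: perm_rowSl.
Qed.

Lemma lam_incrr k i j j' : (0 < k)%N -> (j <= j')%N ->
  lam R k s i j <= lam R k s i j' <= lam R k s i j + (j'%:R - j%:R).
Proof.
move=> k0 jj'; rewrite !lam_perm_row// -natrB// -natrD !ler_nat.
by apply: (@unit_steps (fun j => perm_row s k.-1 i j)) => // m; exact: perm_rowSr.
Qed.

End LamIncrements.

(** * From point configurations to permutations *)

Section PointConfigurations.
Variables (R : realType) (n : nat).

Lemma rank_of_lt (f : 'I_n -> R) a b :
  (rank_of f a < rank_of f b)%N = (f a < f b).
Proof.
apply/idP/idP => [|fab].
  apply: contraTT; rewrite -leNgt -leqNgt => ba; apply/subset_leq_card.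
  by apply/fintype.subsetP => c; rewrite !inE => /lt_le_trans; apply.
apply/proper_card/properP; split.
  by apply/fintype.subsetP => c; rewrite !inE => /lt_trans; apply.
by exists a; rewrite !inE ?ltxx.
Qed.

Lemma rank_of_ltn (f : 'I_n -> R) a : (rank_of f a < n)%N.
Proof.
rewrite -[X in (_ < X)%N](card_ord n) -cardsT; apply/proper_card/properP.
by split; [exact: finset.subsetT|exists a; rewrite !inE ?ltxx].
Qed.

Lemma rank_of_inj (f : 'I_n -> R) : injective f -> injective (rank_of f).
Proof.
move=> f_inj a b ab; apply: f_inj; apply/eqP; rewrite eq_le.
by rewrite !leNgt -!rank_of_lt ab ltnn.
Qed.

Variable Z : 'I_n -> R * R.

Definition point_rel (h h' : 'I_n) : bool :=
  ((Z h).1 < (Z h').1) && ((Z h).2 < (Z h').2).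

Definition point_corner (i j : nat) : {set 'I_n} :=
  [set h | (rank_of (fun a => (Z a).1) h < i)%N &&
           (rank_of (fun a => (Z a).2) h < j)%N]%SET.

(** Each point is sent to its horizontal rank; [s] maps that rank to the vertical one, and ranks
    preserve strict comparisons. *)
Lemma greene_is_Perm (s : 'S_n) k i j : is_Perm Z s ->
  greene (perm_rel s) k (perm_corner s i j) =
  greene point_rel k (point_corner i j).
Proof.
move=> [x_inj y_inj hs]; set x := fun h => (Z h).1; set y := fun h => (Z h).2.
pose e h : 'I_n := Ordinal (rank_of_ltn x h).
have sE h : val (s (e h)) = rank_of y h.
  by rewrite (hs h (e h) (Ordinal (rank_of_ltn y h))).
have e_inj : injective e.
  by move=> a b /(congr1 val) /= /(rank_of_inj x_inj).
symmetry; apply: (@greene_transport _ _ _ _ e).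
- by move=> a b _ _; exact: e_inj.
- apply/setP => h; apply/idP/imsetP => [|[a + ->]]; last first.
    by rewrite !inE sE.
  rewrite !inE => hD; exists (invF e_inj h); last by rewrite f_invF.
  rewrite !inE -/x -/y -sE f_invF.
  by rewrite (_ : rank_of x _ = e (invF e_inj h))// f_invF.
- by move=> a b _ _; rewrite /perm_rel !sE !rank_of_lt.
Qed.

(** Horizontal ranks exhaust ['I_n]. This makes the events attached to different permutations
    disjoint. *)
Lemma is_Perm_inj (s t : 'S_n) : is_Perm Z s -> is_Perm Z t -> s = t.
Proof.
move=> [x_inj y_inj hs] [_ _ ht]; set x := fun h => (Z h).1.
pose e h : 'I_n := Ordinal (rank_of_ltn x h).
have e_inj : injective e.
  by move=> a b /(congr1 val) /= /(rank_of_inj x_inj).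
apply/permP => i; rewrite -(f_invF e_inj i).
pose j : 'I_n := Ordinal (rank_of_ltn (fun a => (Z a).2) (invF e_inj i)).
by rewrite (hs (invF e_inj i) _ j)// (ht (invF e_inj i) _ j).
Qed.

End PointConfigurations.

Local Open Scope classical_set_scope.
Local Open Scope ring_scope.

(** * Concentration of empirical counts *)

Section FiniteUnions.
Context {d : measure_display} {T : measurableType d} {R : realType}.

Lemma measure_bigcup_fin_le (P : {measure set T -> \bar R}) (I : finType)
    (C : pred I) (A : I -> set T) : (forall i, measurable (A i)) ->
  (P (\bigcup_(i in [set` C]) A i) <= \sum_(i | C i) P (A i))%E.
Proof.
move=> mA; rewrite bigcup_pred.
pose K (U : set T) (x : \bar R) := measurable U /\ (P U <= x)%E.
suff : K (\big[setU/set0]_(t in C) A t) (\sum_(i | C i) P (A i))%E by case.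
apply: (big_ind2 K) => [|U x V y [mU Ux] [mV Vy]|i _]; split=> //.
- by rewrite measure0.
- exact: measurableU.
- by apply: le_trans (measureU2 _ mU mV) _; exact: leeD.
Qed.

(** An event that depends only on which of finitely many measurable events occur is a finite union
    of atoms, whatever [Q] is. *)
Lemma measurable_pattern (I : finType) (A : I -> set T) (Q : {set I} -> Prop) :
  (forall i, measurable (A i)) ->
  measurable [set w | Q [set i | `[< A i w >]]%SET].
Proof.
move=> mA.
have -> : [set w | Q [set i | `[< A i w >]]%SET] =
  \bigcup_(J in [set J : {set I} | Q J])
    \bigcap_(i in [set: I]) (if i \in J then A i else ~` A i).
  apply/seteqP; split=> [w /= Qw|w [J /= QJ hw]].
    eexists; first exact: Qw; move=> i _; rewrite inE.
    by case: asboolP.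
  rewrite (_ : [set _ | _]%SET = J)//; apply/setP => i; rewrite inE.
  have := hw i Logic.I; case: (i \in J) => h; first exact/asboolP.
  exact/asboolPn.
apply: fin_bigcup_measurable => // J _.
apply: fin_bigcap_measurable => // i _; case: ifP => _ //.
exact: measurableC.
Qed.

End FiniteUnions.

(** * Chernoff bound for the number of sample points in a set *)

Section Concentration.
Context {R : realType} {d : measure_display} {T : measurableType d}.
Variables (P : probability T R) (n : nat) (mu : probability (plane R) R).
Variable Z : 'I_n -> T -> plane R.
Hypothesis Z_iid : iid P mu Z.

Definition hits (B : set (plane R)) (z : 'I_n -> plane R) : {set 'I_n} :=
  [set h | `[< B (z h) >]]%SET.

Let prob (B : set (plane R)) : R := fine (mu B).

Lemma probE B : measurable B -> mu B = (prob B)%:E.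
Proof. by move=> mB; rewrite /prob fineK// fin_num_measure. Qed.

Lemma probC B : measurable B -> prob (~` B) = 1 - prob B.
Proof. by move=> mB; rewrite /prob probability_setC// probE. Qed.

Lemma prob_itv B : measurable B -> 0 <= prob B <= 1.
Proof.
move=> mB; rewrite fine_ge0//= -lee_fin -probE//.
exact: probability_le1.
Qed.

Lemma measurable_hits B (Q : {set 'I_n} -> Prop) : measurable B ->
  measurable [set w | Q (hits B (fun h => Z h w))].
Proof.
move=> mB; apply: (@measurable_pattern _ _ _ (fun h => Z h @^-1` B)) => h.
have [mZ _ _] := Z_iid; rewrite -[X in measurable X]setTI.
exact: mZ.
Qed.

Lemma hits_law B (J : {set 'I_n}) : measurable B ->
  P [set w | hits B (fun h => Z h w) = J] =
  (\prod_(h < n) (if h \in J then prob B else 1 - prob B))%:E.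
Proof.
move=> mB; have [_ law indep] := Z_iid.
pose A h := if h \in J then B else ~` B.
have mA h : measurable (A h).
  by rewrite /A; case: ifP => _ //; exact: measurableC.
have -> : [set w | hits B (fun h => Z h w) = J] =
    \bigcap_(h in [set` [set: 'I_n]%SET]) (Z h @^-1` A h).
  apply/seteqP; split=> [w /= hJ h _|w hw] /=.
    by rewrite /A -hJ inE; case: asboolP.
  apply/setP => h; rewrite inE; have := hw h; rewrite /= /A inE.
  case: (h \in J) => hB; first by apply/asboolP; exact: hB.
  by apply/asboolPn; exact: hB.
rewrite indep// -prodEFin.
apply: eq_big => [h|h _]; first by rewrite inE.
have := law h _ (mA h); rewrite /pushforward => ->.
by rewrite /A; case: ifP => _; rewrite probE ?probC//; exact: measurableC.
Qed.

(** [expR t * (1 - t) <= 1], whereas [(1 + t + 2 t^2) (1 - t) = 1 + t^2 (1 - 2 t) >= 1] on this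
    interval. *)
Lemma expR_le_quadratic (t : R) : 0 <= t <= 1 / 2 -> expR t - 1 <= t + 2 * t ^+ 2.
Proof.
move=> /andP[t0 t1].
have h1 : 1 - t <= expR (- t) by have := expR_ge1Dx (- t).
have h2 : expR t * expR (- t) = 1 by exact: expRxMexpNx_1.
have h3 : expR t * (1 - t) <= 1.
  by rewrite -[leRHS]h2 ler_wpM2l// expR_ge0.
have h4 : 1 <= (1 + t + 2 * t ^+ 2) * (1 - t) by nra.
have : expR t * (1 - t) <= (1 + t + 2 * t ^+ 2) * (1 - t) by lra.
rewrite ler_pM2r; lra.
Qed.

(* Exponential Markov inequality at [t = eps / 4]. *)
Lemma hits_upper_tail B (eps : R) : measurable B -> 0 < eps <= 1 ->
  (P [set w | ((prob B + eps) * n%:R <= #|hits B (fun h => Z h w)|%:R)%R] <=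
   (expR (- (eps ^+ 2 / 8)) ^+ n)%:E)%E.
Proof.
move=> mB /andP[e0 e1]; have /andP[p0 p1] := prob_itv mB.
set p := prob B in p0 p1 *; pose t := eps / 4.
pose C (J : {set 'I_n}) := ((p + eps) * n%:R <= #|J|%:R)%R.
have -> : [set w | ((p + eps) * n%:R <= #|hits B (fun h => Z h w)|%:R)%R] =
    \bigcup_(J in [set` C]) [set w | hits B (fun h => Z h w) = J].
  apply/seteqP; split=> [w /= Cw|w [J /= CJ hJ]]; last by rewrite hJ.
  by exists (hits B (fun h => Z h w)).
have mJ J : measurable [set w | hits B (fun h => Z h w) = J].
  exact: (measurable_hits (fun K => K = J)).
apply: le_trans (measure_bigcup_fin_le P C mJ) _.
rewrite (eq_bigr _ (fun J _ => hits_law J mB)).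
rewrite sumEFin lee_fin -/p.
(* For [J] in [C] the weight [M * expR (t * #|J|)] is at least 1, so inserting it and summing over
   all [J] only increases the sum. *)
pose M := expR (- (t * ((p + eps) * n%:R))).
apply: (@le_trans _ _ (\sum_(J : {set 'I_n})
    M * \prod_(h < n) (if h \in J then p * expR t else 1 - p))).
  rewrite [leRHS](bigID C) /= -[leLHS]addr0; apply: lerD.
    apply: ler_sum => J CJ.
    have -> : \prod_(h < n) (if h \in J then p * expR t else 1 - p) =
        expR (t * #|J|%:R) * \prod_(h < n) (if h \in J then p else 1 - p).
      rewrite expRM_natr -prodr_const [in RHS]big_mkcond/= -big_split/=.
      by apply: eq_bigr => h _; case: ifP => _; rewrite ?mul1r// mulrC.
    rewrite mulrA -expRD ler_peMl//.
      by apply: prodr_ge0 => h _; case: ifP => _ //; rewrite subr_ge0.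
    rewrite -[leLHS]expR0 ler_expR addrC subr_ge0 ler_wpM2l//.
    by rewrite /t divr_ge0// ltW.
  apply: sumr_ge0 => J _; rewrite mulr_ge0 ?expR_ge0//.
  apply: prodr_ge0 => h _; case: ifP => _; rewrite ?subr_ge0//.
  by rewrite mulr_ge0 ?expR_ge0.
(* The sum over subsets is the expansion of [(p e^t + 1 - p)^n], the exponential moment. *)
rewrite -mulr_sumr -bigA_distr prodr_const card_ord /M.
rewrite mulrA -mulNr expRM_natr -exprMn; apply: lerXn2r.
- by rewrite nnegrE mulr_ge0 ?expR_ge0// addr_ge0 ?mulr_ge0 ?expR_ge0 ?subr_ge0.
- by rewrite nnegrE expR_ge0.
have t01 : 0 <= t <= 1 / 2 by rewrite /t; apply/andP; split; lra.
have h1 := expR_le_quadratic t01.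
have h2 : p * expR t + (1 - p) <= expR (p * (t + 2 * t ^+ 2)).
  apply: le_trans (expR_ge1Dx _).
  have := ler_wpM2l p0 h1; lra.
apply: le_trans (ler_wpM2l (expR_ge0 _) h2) _.
(* The exponent per point is at most [2 t^2 - t eps], which equals [- eps^2 / 8] at
   [t = eps / 4]. *)
rewrite -expRD ler_expR /t; nra.
Qed.

Lemma hits_setC B (z : 'I_n -> plane R) : #|hits (~` B) z| = (n - #|hits B z|)%N.
Proof.
have -> : hits (~` B) z = (~: hits B z)%SET.
  by apply/setP => h; rewrite !inE; exact: asbool_neg.
by rewrite cardsCs finset.setCK card_ord.
Qed.

Definition deviates (eps : R) (B : set (plane R)) (z : 'I_n -> plane R) : Prop :=
  eps * n%:R <= `|#|hits B z|%:R - prob B * n%:R|.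

Lemma measurable_deviates eps B : measurable B ->
  measurable [set w | deviates eps B (fun h => Z h w)].
Proof.
exact: (measurable_hits (fun J => eps * n%:R <= `|#|J|%:R - prob B * n%:R|)).
Qed.

(** The lower tail of [B] is the upper tail of its complement; hence the factor 2. *)
Lemma hits_deviation B (eps : R) : measurable B -> 0 < eps <= 1 ->
  (P [set w | deviates eps B (fun h => Z h w)] <=
   (2 * expR (- (eps ^+ 2 / 8)) ^+ n)%:E)%E.
Proof.
move=> mB e01; have mBc := measurableC mB.
pose U B' := [set w | ((prob B' + eps) * n%:R <= #|hits B' (fun h => Z h w)|%:R)%R].
have mU B' : measurable B' -> measurable (U B').
  exact: (measurable_hits (fun J => (prob B' + eps) * n%:R <= #|J|%:R)%R).
apply: (@le_trans _ _ (P (U B `|` U (~` B)))).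
  apply: le_measure; rewrite ?inE; first exact: measurable_deviates.
    by apply: measurableU; exact: mU.
  move=> w /=; rewrite /deviates /U /= hits_setC natrB; last first.
    by rewrite -[X in (_ <= X)%N]card_ord max_card.
  rewrite probC// ler_normr => /orP[h|h]; [left|right]; lra.
apply: le_trans (measureU2 _ (mU _ mB) (mU _ mBc)) _.
rewrite mulr_natl mulr2n EFinD; apply: leeD; exact: hits_upper_tail.
Qed.

End Concentration.

(** * Dyadic boxes and compactness *)

Section Boxes.
Variable R : realType.
Implicit Types (A : set (R * R)) (z : R * R) (j : nat).

(** One index more than [2 ^ j] per axis, because the coordinate 1 truncates to [2 ^ j]. *)
Definition cell_index j : finType := ('I_(2 ^ j).+1 * 'I_(2 ^ j).+1)%type.

Definition closed_cell j (c : cell_index j) : set (R * R) :=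
  `[c.1%:R / (2 ^ j)%:R, c.1.+1%:R / (2 ^ j)%:R] `*`
  `[c.2%:R / (2 ^ j)%:R, c.2.+1%:R / (2 ^ j)%:R].

(** Half-open cells select the indices, so that a point determines its cell; boxes are built from
    the closed cells, so that they are closed. *)
Definition in_cell j (c : cell_index j) z : Prop :=
  Num.truncn (z.1 * (2 ^ j)%:R) = c.1 /\ Num.truncn (z.2 * (2 ^ j)%:R) = c.2.

Definition cells j A : {set cell_index j} :=
  [set c | `[< exists2 z, A z & in_cell c z >]]%SET.

Definition box j (C : {set cell_index j}) : set (R * R) :=
  \bigcup_(c in [set` C]) closed_cell c.

Lemma measurable_box j (C : {set cell_index j}) :
  measurable (box C : set (plane R)).
Proof.
apply: fin_bigcup_measurable => // c _.
by apply: measurableX; exact: measurable_itv.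
Qed.

Lemma closed_box j (C : {set cell_index j}) : closed (box C).
Proof.
apply: closed_bigcup => // c _.
rewrite /closed_cell -[X in closed X]/((fst @^-1` _) `&` (snd @^-1` _)).
apply: closedI; apply: closed_comp; try exact: itv_closed.
  by move=> z _; exact: cvg_fst.
by move=> z _; exact: cvg_snd.
Qed.

Lemma exists_cell j z : unit_square R z -> exists c : cell_index j, in_cell c z.
Proof.
move=> [/= /[!in_itv]/= /andP[x0 x1] /andP[y0 y1]].
have lt_trunc (t : R) : t <= 1 -> (Num.truncn (t * (2 ^ j)%:R) < (2 ^ j).+1)%N.
  move=> t1; rewrite ltnS truncn_le_nat.
  apply: (@le_lt_trans _ _ (2 ^ j)%:R); last by rewrite ltr_nat.
  by rewrite ler_piMl// ltW.
by exists (Ordinal (lt_trunc _ x1), Ordinal (lt_trunc _ y1)).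
Qed.

Lemma in_cell_closed j (c : cell_index j) z :
  unit_square R z -> in_cell c z -> closed_cell c z.
Proof.
move=> [/= /[!in_itv]/= /andP[x0 x1] /andP[y0 y1]] [c1 c2].
have trunc_itv (t : R) : 0 <= t -> (Num.truncn (t * (2 ^ j)%:R))%:R / (2 ^ j)%:R <= t
    <= (Num.truncn (t * (2 ^ j)%:R)).+1%:R / (2 ^ j)%:R.
  move=> t0; rewrite ler_pdivrMr// ler_pdivlMr//.
  have /andP[-> /ltW ->//] : (Num.truncn (t * (2 ^ j)%:R))%:R <=
    t * (2 ^ j)%:R < (Num.truncn (t * (2 ^ j)%:R)).+1%:R.
  by apply: truncn_itv; rewrite mulr_ge0// ltW.
by split; rewrite /= in_itv/= -?c1 -?c2; exact: trunc_itv.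
Qed.

Lemma sub_box_cells j A : A `<=` unit_square R -> A `<=` box (cells j A).
Proof.
move=> AU z Az; have [c cz] := exists_cell j (AU _ Az).
exists c => /=; last exact: in_cell_closed (AU _ Az) cz.
by rewrite inE; apply/asboolP; exists z.
Qed.

Lemma box_cells_near j A z : A `<=` unit_square R -> box (cells j A) z ->
  exists2 z', A z' & `|z.1 - z'.1| <= (2 ^ j)%:R^-1 /\ `|z.2 - z'.2| <= (2 ^ j)%:R^-1.
Proof.
move=> AU [c /= /[!inE] hc cz]; case: hc => z' Az' cz'; exists z' => //.
have := in_cell_closed (AU _ Az') cz'.
case: cz => /= /[!in_itv]/= h1 h2 [/= /[!in_itv]/= h3 h4].
move: h1 h2 h3 h4; rewrite -!natr1 !mulrDl !mul1r.
by move=> *; split; rewrite ler_norml; lra.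
Qed.

(** If a coordinate truncates to [m] at scale [j], it truncates to [2 m] or [2 m + 1] at the next
    scale: each child cell lies inside its parent. *)
Lemma box_cellsS j A : A `<=` unit_square R ->
  box (cells j.+1 A) `<=` box (cells j A).
Proof.
move=> AU z [c /= /[!inE] hc cz]; case: hc => z' Az' cz'.
have [b bz'] := exists_cell j (AU _ Az'); exists b => /=.
  by rewrite inE; apply/asboolP; exists z'.
have half (t : R) : 0 <= t ->
    ((Num.truncn (t * (2 ^ j)%:R)).*2 <= Num.truncn (t * (2 ^ j.+1)%:R) <=
     (Num.truncn (t * (2 ^ j)%:R)).*2.+1)%N.
  move=> t0; have t0' : 0 <= t * (2 ^ j)%:R by rewrite mulr_ge0// ltW.
  have /andP[h1 h2] := truncn_itv t0'.
  have E : t * (2 ^ j.+1)%:R = 2 * (t * (2 ^ j)%:R).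
    by rewrite expnS natrM; ring.
  rewrite E truncn_ge_nat ?mulr_ge0// truncn_le_nat.
  move: h1 h2; rewrite -!natr1 -!muln2 !natrM => h1 h2.
  by apply/andP; split; lra.
have /AU[/= /[!in_itv]/= /andP[x0 _] /andP[y0 _]] := Az'.
move: (half _ x0) (half _ y0); case: cz' bz' => -> -> [-> ->] h1 h2.
have sub (m n : nat) (t : R) : (m.*2 <= n <= m.*2.+1)%N ->
    n%:R / (2 ^ j.+1)%:R <= t <= n.+1%:R / (2 ^ j.+1)%:R ->
    m%:R / (2 ^ j)%:R <= t <= m.+1%:R / (2 ^ j)%:R.
  move=> /andP[mn nm].
  rewrite !ler_pdivrMr// !ler_pdivlMr// expnS natrM.
  have hm : 2 * m%:R <= n%:R :> R by rewrite -natrM ler_nat mul2n.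
  have hn : n%:R <= 2 * m%:R + 1 :> R.
    by rewrite -natrM natr1 ler_nat mul2n.
  by rewrite -!natr1; lra.
case: cz => /= /[!in_itv]/= h3 h4; split; rewrite /= in_itv/=.
  exact: sub h1 h3.
exact: sub h2 h4.
Qed.

Lemma box_cells_anti i j A : A `<=` unit_square R -> (i <= j)%N ->
  box (cells j A) `<=` box (cells i A).
Proof.
move=> AU /subnK <-; elim: (j - i)%N => [//|m IH] z.
by rewrite addSn => /box_cellsS => /(_ AU)/IH.
Qed.

Lemma box_cells_bigcup j k (F : 'I_k -> set (R * R)) :
  box (cells j (\bigcup_a F a)) = \bigcup_a box (cells j (F a)).
Proof.
apply/seteqP; split=> z.
  move=> [c /= /[!inE] hc cz]; case: hc => z' [a _ Fz'] cz'.
  by exists a => //; exists c => //=; rewrite inE; apply/asboolP; exists z'.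
move=> [a _ [c /= /[!inE] hc cz]]; case: hc => z' Fz' cz'.
by exists c => //=; rewrite inE; apply/asboolP; exists z' => //; exists a.
Qed.

Lemma pow2_inv_small (e : R) : 0 < e -> exists j, (2 ^ j)%:R^-1 < e.
Proof.
move=> e0; exists (Num.truncn e^-1).
rewrite invf_plt ?posrE//; apply: lt_le_trans (truncnS_gt _) _.
by rewrite ler_nat ltn_expl.
Qed.

(** Points of all boxes are limits of points of [A]. This also yields measurability of closed sets
    for the product sigma-algebra. *)
Lemma closed_cap_box A : closed A -> A `<=` unit_square R ->
  A = \bigcap_j box (cells j A).
Proof.
move=> cA AU; apply/seteqP; split=> [z Az j _|z hz]; first exact: sub_box_cells.
apply: cA => V /nbhs_ballP[e /= e0 eV].
have [j je] := pow2_inv_small e0.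
have [z' Az' [h1 h2]] := box_cells_near AU (hz j Logic.I).
exists z'; split=> //; apply: eV; split=> /=.
  exact: le_lt_trans h1 je.
exact: le_lt_trans h2 je.
Qed.

Lemma closed_measurable A : closed A -> A `<=` unit_square R ->
  measurable (A : set (plane R)).
Proof.
move=> cA AU; rewrite (closed_cap_box cA AU).
by apply: bigcapT_measurable => j; exact: measurable_box.
Qed.

Lemma nondecreasing_limit A :
  (forall p q (e : R), A p -> A q -> 0 < e -> exists p' q' : R * R,
    [/\ `|p.1 - p'.1| <= e, `|p.2 - p'.2| <= e, `|q.1 - q'.1| <= e,
        `|q.2 - q'.2| <= e & 0 <= (q'.1 - p'.1) * (q'.2 - p'.2)]) ->
  nondecreasing_set A.
Proof.
move=> h p q Ap Aq; rewrite leNgt; apply/negP => lt0.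
set u := q.1 - p.1 in lt0; set v := q.2 - p.2 in lt0.
have u0 : u != 0 by apply: contraTneq lt0 => ->; rewrite mul0r ltxx.
have v0 : v != 0 by apply: contraTneq lt0 => ->; rewrite mulr0 ltxx.
(* A difference of two coordinates moves by at most [2 e], less than [|u|] and [|v|], so both signs
   survive the perturbation. *)
pose e := Num.min `|u| `|v| / 3.
have e0 : 0 < e by rewrite divr_gt0// lt_min !normr_gt0 u0 v0.
have eu : e * 3 <= `|u| by rewrite /e divfK// ge_min lexx.
have ev : e * 3 <= `|v| by rewrite /e divfK// ge_min lexx orbT.
have [p' [q' []]] := h p q e Ap Aq e0.
rewrite !ler_norml => /andP[a1 a2] /andP[a3 a4] /andP[a5 a6] /andP[a7 a8].
apply/negP; rewrite -ltNge.
have [up|un|/esym/eqP] := ltgtP 0 u; last by rewrite (negbTE u0).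
  have vn : v < 0 by rewrite -(pmulr_rlt0 _ up).
  rewrite gtr0_norm// in eu; rewrite ltr0_norm// in ev.
  rewrite pmulr_rlt0; rewrite /u /v in eu ev; lra.
have vp : 0 < v by rewrite -(nmulr_rlt0 _ un).
rewrite ltr0_norm// in eu; rewrite gtr0_norm// in ev.
rewrite nmulr_rlt0; rewrite /u /v in eu ev; lra.
Qed.

End Boxes.

(** Pigeonhole along an ultrafilter; it replaces a diagonal extraction over the scales. *)
Lemma ultra_constant (X : finType) (U : set_system nat) (x : nat -> X) :
  UltraFilter U -> exists y, U [set n | x n = y].
Proof.
move=> hU; have FU : ProperFilter U := @ultra_proper _ _ hU.
apply/not_existsP => h.
have hc y : U [set n | x n <> y].
  by have [/h|] := in_ultra_setVsetC [set n | x n = y] hU.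
have : \forall n \near U, forall y, x n <> y by exact: filter_forall.
by move=> /filter_ex[n /(_ (x n))]; apply.
Qed.

(** * The variational quantity and its approximation by boxes *)

Section Variational.
Variables (R : realType) (mu : probability (plane R) R) (x y : R).
Hypotheses (x01 : x \in `[0, 1]) (y01 : y \in `[0, 1]).
Local Notation C := (corner x y).

Lemma corner_sub_unit_square : C `<=` unit_square R.
Proof.
move=> z [/= /[!in_itv]/= /andP[a b] /andP[c e]].
move: x01 y01; rewrite !in_itv/= => /andP[_ x1] /andP[_ y1].
by split=> /=; rewrite in_itv/= ?a ?c ?(le_trans b)// (le_trans e).
Qed.

Definition admissible k (A : set (R * R)) :=
  [/\ closed A, A `<=` unit_square R & k_nondecreasing_set k A].

Let tLIS_set k := [set restr_corner mu x y A | A in [set A | admissible k A]].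

Let tLIS_fin k : ereal_sup (tLIS_set k) \is a fin_num.
Proof.
rewrite ge0_fin_numE.
  apply: (@le_lt_trans _ _ 1%E); last exact: ltry.
  apply: ge_ereal_sup => _ [A [cA AU _] <-].
  apply: probability_le1; apply: measurableI; last exact: measurable_corner.
  exact: closed_measurable.
apply: ereal_sup_ubound; exists set0; last by rewrite measure0.
split=> //; first exact: closed0.
exists (fun=> set0); split; first by move=> a p q.
by rewrite bigcup0.
Qed.

Lemma tLIS_ge k A : admissible k A ->
  fine (mu (A `&` C)) <= tLIS k (restr_corner mu x y).
Proof.
move=> hA; rewrite -lee_fin fineK; last first.
  apply: fin_num_measure; apply: measurableI; last exact: measurable_corner.
  by case: hA => cA AU _; exact: closed_measurable.
rewrite /tLIS fineK; last exact: tLIS_fin.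
by apply: ereal_sup_ubound; exists A.
Qed.

Lemma tLIS_adherent k (e : R) : 0 < e -> exists2 A, admissible k A &
  tLIS k (restr_corner mu x y) - e < fine (mu (A `&` C)).
Proof.
move=> e0; have [_ [A hA <-] hlt] := ub_ereal_sup_adherent e0 (tLIS_fin k).
exists A => //; rewrite -lte_fin fineK; last first.
  apply: fin_num_measure; apply: measurableI; last exact: measurable_corner.
  by case: hA => cA AU _; exact: closed_measurable.
by rewrite EFinB /tLIS fineK; [exact: hlt|exact: tLIS_fin].
Qed.

(* Compactness: if all scales [j] were bad, an ultrafilter would select at each
   scale a limiting family of cells; the limiting boxes decrease with [j], and
   their intersection is admissible and has too large a measure. *)
Lemma box_cells_tLIS k (e : R) : 0 < e -> exists j,
  forall F : 'I_k -> set (R * R),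
    (forall a, nondecreasing_set (F a)) -> (forall a, F a `<=` unit_square R) ->
    fine (mu (box (cells j (\bigcup_a F a)) `&` C)) <=
    tLIS k (restr_corner mu x y) + e.
Proof.
move=> e0; apply/not_existsP => bad.
have {bad}/choice[F hF] : forall j, exists F : 'I_k -> set (R * R),
    [/\ forall a, nondecreasing_set (F a), forall a, F a `<=` unit_square R &
        tLIS k (restr_corner mu x y) + e <
          fine (mu (box (cells j (\bigcup_a F a)) `&` C))].
  move=> j; apply: contrapT => nF; apply: (bad j) => F F1 F2.
  by rewrite leNgt; apply/negP => F3; apply: nF; exists F.
have [U [hU ooU]] := @ultraFilterLemma _ (\oo : set_system nat) _.
have FU : ProperFilter U := @ultra_proper _ _ hU.
pose X j n : {ffun 'I_k -> {set cell_index j}} := [ffun a => cells j (F n a)].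
pose Y j := projT1 (cid (ultra_constant (X j) hU)).
have hY j : U [set n | X j n = Y j] by exact: (projT2 (cid (ultra_constant (X j) hU))).
have Uge j : U [set n | (j <= n)%N] by apply: ooU; exists j.
(* A single [n] realises the limiting families at two scales at once, so inclusions between scales
   pass to the limit. *)
have pick i j : exists n, [/\ (j <= n)%N, forall a, cells i (F n a) = Y i a &
    forall a, cells j (F n a) = Y j a].
  have : U ([set n | (j <= n)%N] `&` ([set n | X i n = Y i] `&`
    [set n | X j n = Y j])) by do 2?[apply: filterI => //].
  move=> /filter_ex[n [h1 [h2 h3]]].
  by exists n; split=> // a; [rewrite -h2|rewrite -h3]; rewrite ffunE.
pose L j a : set (R * R) := box (Y j a).
have L_anti a i j : (i <= j)%N -> L j a `<=` L i a.
  move=> ij; have [n [_ h1 h2]] := pick i j; rewrite /L -h1 -h2.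
  by have [_ hFU _] := hF n; exact: box_cells_anti.
pose B j := \bigcup_a L j a.
have B_anti i j : (i <= j)%N -> B j `<=` B i.
  by move=> ij z [a _ Lz]; exists a => //; exact: L_anti Lz.
have mB j : measurable (B j : set (plane R)).
  apply: fin_bigcup_measurable => [|a _]; first exact: finite_finset.
  exact: measurable_box.
have mBC j : measurable ((B j : set (plane R)) `&` C).
  by apply: measurableI => //; exact: measurable_corner.
(* The family [F n] is bad at its own scale [n >= j], and its box at the coarser scale [j] is
   larger. *)
have B_big j : tLIS k (restr_corner mu x y) + e < fine (mu (B j `&` C)).
  have [n [jn h _]] := pick j j; have [_ hFU hlt] := hF n.
  apply: lt_le_trans hlt _; apply: fine_le.
  - apply: fin_num_measure; apply: measurableI; last exact: measurable_corner.
    exact: measurable_box.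
  - exact: fin_num_measure.
  apply: le_measure; rewrite ?inE//.
    by apply: measurableI; [exact: measurable_box|exact: measurable_corner].
  have -> : B j = box (cells j (\bigcup_a F n a)).
    by rewrite box_cells_bigcup; apply: eq_bigcupr => a _; rewrite /L -h.
  apply: setSI; apply: box_cells_anti => // z [a _].
  exact: hFU.
(* The closed cells of index [2 ^ j] stick out of the unit square, hence the intersection. *)
pose Ai a := unit_square R `&` \bigcap_j L j a.
pose A := \bigcup_a Ai a.
have AE : A = unit_square R `&` \bigcap_j B j.
  apply/seteqP; split=> [z [a _ [zU zL]]|z [zU zB]].
    by split=> // j _; exists a => //; exact: zL.
  (* The index of a box containing [z] may vary with [j]; the ultrafilter finds one that serves
     arbitrarily large scales, and the boxes decrease. *)
  suff [a ha] : exists a, forall j, L j a z.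
    by exists a => //; split=> // j _; exact: ha.
  have /choice[b hb] : forall j, exists a, L j a z.
    by move=> j; have [a _ La] := zB j Logic.I; exists a.
  have [a ha] := ultra_constant b hU.
  exists a => j.
  have : U ([set n | (j <= n)%N] `&` [set n | b n = a]) by exact: filterI.
  move=> /filter_ex[n [/= jn na]].
  by apply: (L_anti _ _ _ jn); rewrite -na.
have hA : admissible k A.
  split.
  - rewrite AE; apply: closedI.
      rewrite /unit_square -[X in closed X]/((fst @^-1` _) `&` (snd @^-1` _)).
      apply: closedI; apply: closed_comp; try exact: itv_closed.
        by move=> z _; exact: cvg_fst.
      by move=> z _; exact: cvg_snd.
    apply: closed_bigI => j _.
    apply: closed_bigcup => [|a _]; first exact: finite_finset.
    exact: closed_box.
  - by rewrite AE => z [].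
  exists Ai; split=> // a; apply: nondecreasing_limit => p q d [_ pL] [_ qL] d0.
  have [j jd] := pow2_inv_small d0.
  have [n [_ h _]] := pick j j; have [Fn hFU _] := hF n.
  have := pL j Logic.I; rewrite /L -h => /(box_cells_near (hFU a))[p' Fp' [p1 p2]].
  have := qL j Logic.I; rewrite /L -h => /(box_cells_near (hFU a))[q' Fq' [q1 q2]].
  exists p', q'; split; last exact: Fn a _ _ Fp' Fq'.
  - exact: le_trans p1 (ltW jd).
  - exact: le_trans p2 (ltW jd).
  - exact: le_trans q1 (ltW jd).
  - exact: le_trans q2 (ltW jd).
have := tLIS_ge hA; apply/negP; rewrite -ltNge.
have AC : A `&` C = \bigcap_j (B j `&` C).
  rewrite AE; apply/seteqP; split=> [z [[_ zB] zC] j _|z zBC].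
    by split=> //; exact: zB.
  have [_ zC] := zBC 0%N Logic.I; split=> //.
  split; first exact: corner_sub_unit_square.
  by move=> j _; have [] := zBC j Logic.I.
have mcap : measurable (\bigcap_j ((B j : set (plane R)) `&` C)).
  exact: bigcapT_measurable.
have cvgB : mu (B j `&` C) @[j --> \oo] --> mu (\bigcap_j (B j `&` C)).
  apply: nonincreasing_cvg_mu => //.
    by apply: (le_lt_trans (probability_le1 _ (mBC 0%N))); exact: ltry.
  by move=> i j ij; apply/subsetPset; apply: setSI; exact: B_anti.
(* Continuity from above keeps only a weak inequality, but the margin [e] still contradicts
   [tLIS_ge]. *)
rewrite AC; apply: (@lt_le_trans _ _ (tLIS k (restr_corner mu x y) + e)).
  by rewrite ltrDl.
rewrite -lee_fin fineK ?fin_num_measure//.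
apply: (cvge_ge _ cvgB); apply: nearW => j /=.
by rewrite -[leRHS]fineK ?fin_num_measure// lee_fin ltW.
Qed.

End Variational.

(** * Comparison of a permutation with the permuton *)

Section PermutonMarginals.
Variables (R : realType) (mu : probability (plane R) R).
Hypothesis hmu : permuton mu.
Local Notation leb := (@lebesgue_measure R).

Lemma uniform_prob01 (A : set (measurableTypeR R)) : measurable A ->
  uniform_prob (@ltr01 R) A = leb (A `&` `[0, 1]).
Proof.
move=> mA; rewrite /uniform_prob integral_uniform_pdf.
rewrite (eq_integral (cst 1%E)); last first.
  move=> t; rewrite inE => -[_ /=]; rewrite in_itv/= => t01.
  by rewrite /uniform_pdf t01 subr0 invr1.
by rewrite integral_cst ?mul1e//; apply: measurableI.
Qed.

Lemma lebesgue_strip01 (t : R) : t \in `[0, 1] ->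
  leb (`]-oo, t] `&` `[0, 1]) = t%:E.
Proof.
rewrite in_itv/= => /andP[t0 t1].
have -> : `]-oo, t] `&` `[0, 1] = `[0, t]%classic :> set R.
  apply/seteqP; split=> s /=; rewrite !in_itv/=.
    by move=> [-> /andP[-> _]].
  by move=> /andP[s0 st]; rewrite st s0 (le_trans st t1).
rewrite lebesgue_measure_itv/= lte_fin; case: ltP => h; first by rewrite sube0.
by congr EFin; lra.
Qed.

Lemma permuton_strip1 (t : R) : t \in `[0, 1] ->
  fine (mu [set z | z.1 <= t]) = t.
Proof.
move=> t01; have [+ _] := hmu (measurable_itv `]-oo, t]); rewrite /pushforward.
rewrite uniform_prob01// lebesgue_strip01// set_itvNyc => E.
by rewrite [X in fine X]E.
Qed.

Lemma permuton_strip2 (t : R) : t \in `[0, 1] ->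
  fine (mu [set z | z.2 <= t]) = t.
Proof.
move=> t01; have [_ +] := hmu (measurable_itv `]-oo, t]); rewrite /pushforward.
rewrite uniform_prob01// lebesgue_strip01// set_itvNyc => E.
by rewrite [X in fine X]E.
Qed.

Lemma measurable_unit_square : measurable (unit_square R : set (plane R)).
Proof. by apply: measurableX; exact: measurable_itv. Qed.

Lemma permuton_unit_squareC : fine (mu (~` unit_square R)) = 0.
Proof.
have mI : measurable (~` `[0, 1] : set (measurableTypeR R)).
  by apply: measurableC; exact: measurable_itv.
have E0 : uniform_prob (@ltr01 R) (~` `[0, 1]) = 0%E.
  by rewrite uniform_prob01// setICl measure0.
have [h1 h2] := hmu mI; rewrite E0 in h1 h2.
suff -> : mu (~` unit_square R) = 0%E by [].
apply/eqP; rewrite eq_le measure_ge0 andbT.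
have m1 : measurable ((fun z : plane R => z.1) @^-1` (~` `[0, 1])).
  by rewrite -[X in measurable X]setTI; exact: measurable_fst.
have m2 : measurable ((fun z : plane R => z.2) @^-1` (~` `[0, 1])).
  by rewrite -[X in measurable X]setTI; exact: measurable_snd.
apply: (@le_trans _ _ (mu ((fun z : plane R => z.1) @^-1` (~` `[0, 1]) `|`
    (fun z : plane R => z.2) @^-1` (~` `[0, 1])))).
  apply: le_measure; rewrite ?inE.
  - by apply: measurableC; exact: measurable_unit_square.
  - exact: measurableU.
  - move=> z zU; have [z1|z1] := pselect (`[0, 1]%classic z.1); last by left.
    by right => z2; apply: zU.
apply: le_trans (measureU2 _ m1 m2) _.
by rewrite [X in (X + _)%E]h1 [X in (_ + X)%E]h2 adde0.
Qed.

End PermutonMarginals.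

(** * Strips cut by rank and strips cut by coordinate *)

Section RankCounting.
Variables (R : realType) (n : nat).

Lemma card_rank_lt (f : 'I_n -> R) (i : nat) : injective f -> (i <= n)%N ->
  #|[set h | (rank_of f h < i)%N]%SET| = i.
Proof.
move=> f_inj le_in; pose e h : 'I_n := Ordinal (rank_of_ltn f h).
have e_inj : injective e by move=> a b /(congr1 val) /= /(rank_of_inj f_inj).
rewrite -(card_imset _ e_inj).
have -> : (e @: [set h | (rank_of f h < i)%N])%SET =
    [set widen_ord le_in a | a : 'I_i]%SET.
  apply/setP => b; apply/imsetP/imsetP => [[h]|[a _ ->]].
    rewrite inE => hi ->; exists (Ordinal hi) => //.
    exact: val_inj.
  exists (invF e_inj (widen_ord le_in a)); last by rewrite f_invF.
  rewrite inE (_ : rank_of f _ = e (invF e_inj (widen_ord le_in a)))//.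
  by rewrite f_invF /=.
rewrite card_imset ?card_ord// => a b /(congr1 val) /= ab; exact: val_inj.
Qed.

(** Both sets are initial segments for the order given by [f], hence nested, and their difference is
    governed by cardinalities alone. *)
Lemma rank_sublevel (f : 'I_n -> R) (t : R) (i : nat) : injective f -> (i <= n)%N ->
  let S := [set h | f h <= t]%SET in
  let D := [set h | (rank_of f h < i)%N]%SET in
  ((S :\: D)%SET = finset.set0 /\ #|D :\: S|%SET = (i - #|S|)%N) \/
  ((D :\: S)%SET = finset.set0 /\ #|S :\: D|%SET = (#|S| - i)%N).
Proof.
move=> f_inj le_in S D; have cD : #|D| = i by exact: card_rank_lt.
have [SD|] := boolP (S \subset D).
  left; split; first by apply/eqP; rewrite finset.setD_eq0.
  by rewrite cardsD (finset.setIidPr SD) cD.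
move=> /fintype.subsetPn[h hS hD]; right.
have DS : D \subset S.
  apply/fintype.subsetP => g; rewrite !inE => gi.
  move: hS hD; rewrite !inE -leqNgt => ht ih; apply: le_trans ht.
  by apply: ltW; rewrite -rank_of_lt; exact: leq_trans ih.
split; first by apply/eqP; rewrite finset.setD_eq0.
by rewrite cardsD (finset.setIidPr DS) cD.
Qed.

Lemma rank_sublevel_bound (f : 'I_n -> R) (t e : R) (i : nat) :
  injective f -> (i <= n)%N ->
  `|#|[set h | f h <= t]%SET|%:R - i%:R| <= e ->
  #|[set h | f h <= t] :\: [set h | (rank_of f h < i)%N]|%SET%:R <= e /\
  #|[set h | (rank_of f h < i)%N] :\: [set h | f h <= t]|%SET%:R <= e.
Proof.
move=> f_inj le_in he; have e0 : 0 <= e by apply: le_trans he.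
have sub (a b : nat) : `|a%:R - b%:R| <= e -> (a - b)%:R <= e /\ (b - a)%:R <= e.
  move=> h; have [ab|/ltnW ba] := leqP a b.
    rewrite (eqP ab) natrB//; split=> //.
    by apply: le_trans (ler_norm _) _; rewrite distrC.
  rewrite (eqP ba) natrB//; split=> //.
  exact: le_trans (ler_norm _) _.
have [h1 h2] := sub _ _ he.
have [[-> ->]|[-> ->]] := rank_sublevel t f_inj le_in; rewrite cards0; split=> //.
Qed.

End RankCounting.

(** * Deterministic comparison when all test counts are near their means *)

Section Deterministic.
Variables (R : realType) (mu : probability (plane R) R).
Hypothesis hmu : permuton mu.
Variables (x y : R) (x01 : x \in `[0, 1]) (y01 : y \in `[0, 1]).
Variables (k j : nat) (eps : R) (A : set (R * R)).
Hypothesis hA : admissible k A.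
Hypothesis hAe : tLIS k (restr_corner mu x y) - eps < fine (mu (A `&` corner x y)).
Hypothesis hj : forall F : 'I_k -> set (R * R),
  (forall a, nondecreasing_set (F a)) -> (forall a, F a `<=` unit_square R) ->
  fine (mu (box (cells j (\bigcup_a F a)) `&` corner x y)) <=
  tLIS k (restr_corner mu x y) + eps.

(** The boxes serve the upper bound and [A] the lower one; the two strips convert coordinates into
    ranks, and the null complement of the square controls stray points. *)
Definition test_set (i : {set cell_index j} + 'I_4) : set (plane R) :=
  match i with
  | inl D => box D `&` corner x y
  | inr i => nth set0 [:: [set z | z.1 <= x]; [set z | z.2 <= y];
                         ~` unit_square R; A `&` corner x y] i
  end.

Lemma measurable_test_set i : measurable (test_set i).
Proof.
case: i => [D|[[|[|[|[|//]]]] i4]] /=.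
- by apply: measurableI; [exact: measurable_box|exact: measurable_corner].
- rewrite -[X in measurable X]/(fst @^-1` [set t | t <= x]) -set_itvNyc.
  rewrite -[X in measurable X]setTI.
  by apply: measurable_fst => //; exact: measurable_itv.
- rewrite -[X in measurable X]/(snd @^-1` [set t | t <= y]) -set_itvNyc.
  rewrite -[X in measurable X]setTI.
  by apply: measurable_snd => //; exact: measurable_itv.
- by apply: measurableC; exact: measurable_unit_square.
- have [cA AU _] := hA.
  by apply: measurableI; [exact: closed_measurable|exact: measurable_corner].
Qed.

Variables (n : nat) (z : 'I_n -> plane R) (s : 'S_n).
Hypothesis zs : is_Perm z s.
Hypothesis hdev : forall i, ~ deviates mu eps (test_set i) z.

Let N (B : set (plane R)) : R := #|hits B z|%:R.

Let hits_near i : `|N (test_set i) - fine (mu (test_set i)) * n%:R| < eps * n%:R.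
Proof. by rewrite ltNge; apply/negP; exact: hdev. Qed.

Let e := eps * n%:R.
Let tx := Num.truncn (x * n%:R).
Let ty := Num.truncn (y * n%:R).
Let D := point_corner z tx ty.
Let f1 h := (z h).1.
Let f2 h := (z h).2.
Let S1 := [set h | f1 h <= x]%SET.
Let S2 := [set h | f2 h <= y]%SET.
Let D1 := [set h | (rank_of f1 h < tx)%N]%SET.
Let D2 := [set h | (rank_of f2 h < ty)%N]%SET.

Let trunc_near (t : R) : t \in `[0, 1] ->
  (Num.truncn (t * n%:R) <= n)%N /\ `|t * n%:R - (Num.truncn (t * n%:R))%:R| <= 1.
Proof.
rewrite in_itv/= => /andP[t0 t1]; have tn0 : 0 <= t * n%:R by rewrite mulr_ge0.
have /andP[h1 h2] := truncn_itv tn0; split.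
  rewrite -(@ler_nat R); apply: le_trans h1 _.
  by rewrite ler_piMl.
by rewrite ger0_norm ?subr_ge0// lerBlDl natr1 ltW.
Qed.

(** The strip has mass [x] by uniformity of the marginal: [e] bounds the deviation of its count, and
    1 the truncation of [x * n]. *)
Let S1D1 : #|S1 :\: D1|%SET%:R <= e + 1 /\ #|D1 :\: S1|%SET%:R <= e + 1.
Proof.
have [x_inj _ _] := zs; have [txn xtx] := trunc_near x01.
apply: rank_sublevel_bound => //.
have := hits_near (inr (inord 0)); rewrite /test_set inordK//= permuton_strip1//.
have -> : N [set z | z.1 <= x] = #|S1|%:R.
  by congr (_%:R); apply: eq_card => h; rewrite !inE; apply/asboolP/idP.
rewrite -/e -/tx => hh; rewrite -[X in `|X|](subrKA (x * n%:R)).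
apply: le_trans (ler_normD _ _) _; apply: lerD => //.
exact: ltW.
Qed.

Let S2D2 : #|S2 :\: D2|%SET%:R <= e + 1 /\ #|D2 :\: S2|%SET%:R <= e + 1.
Proof.
have [_ y_inj _] := zs; have [tyn yty] := trunc_near y01.
apply: rank_sublevel_bound => //.
have := hits_near (inr (inord 1)); rewrite /test_set inordK//= permuton_strip2//.
have -> : N [set z | z.2 <= y] = #|S2|%:R.
  by congr (_%:R); apply: eq_card => h; rewrite !inE; apply/asboolP/idP.
rewrite -/e -/ty => hh; rewrite -[X in `|X|](subrKA (y * n%:R)).
apply: le_trans (ler_normD _ _) _; apply: lerD => //.
exact: ltW.
Qed.

(** Distinct coordinates turn the weak order of a nondecreasing set into the strict order of
    [point_rel]. *)
Let nondecreasing_chain (B : set (R * R)) (I : {set 'I_n}) :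
  nondecreasing_set B -> (forall h, h \in I -> B (z h)) -> chain (point_rel z) I.
Proof.
have [x_inj y_inj _] := zs.
move=> ndB IB; apply/chainP => g h gI hI gh.
have x_neq : (z g).1 != (z h).1 by apply: contra gh => /eqP/x_inj ->.
have y_neq : (z g).2 != (z h).2 by apply: contra gh => /eqP/y_inj ->.
have := ndB _ _ (IB _ gI) (IB _ hI); rewrite /point_rel.
have [xl|xl|xe] := ltgtP (z g).1 (z h).1; last by rewrite xe eqxx in x_neq.
- rewrite pmulr_rge0 ?subr_gt0// subr_ge0 le_eqVlt (negbTE y_neq)/=.
  by move=> ->.
- rewrite nmulr_rge0 ?subr_lt0// subr_le0 le_eqVlt eq_sym (negbTE y_neq)/=.
  by move=> ->; rewrite ?orbT.
Qed.

Let G := greene (point_rel z) k D.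

(** The loss is [e] for the near-optimality of [A], [e] for its count, and [e + 1] for each
    strip. *)
Let lower : n%:R * tLIS k (restr_corner mu x y) - 4 * e - 2 <= G%:R.
Proof.
have [_ _ [F [ndF AF]]] := hA.
pose U a : {set 'I_n} := (hits (F a `&` corner x y) z :&: D)%SET.
have hU a : chain (point_rel z) (U a) /\ U a \subset D.
  split; last exact: finset.subsetIr.
  apply: (@nondecreasing_chain (F a)) => // h; rewrite !inE => /andP[+ _].
  by move=> /asboolP[].
have hG : (#|\bigcup_a U a|%SET <= G)%N by exact: greene_ge.
set H := hits (A `&` corner x y) z.
have HU : H \subset ((\bigcup_a U a) :|: ((S1 :\: D1) :|: (S2 :\: D2)))%SET.
  apply/fintype.subsetP => h; rewrite !inE => -[].
  rewrite AF => -[a _ Fa] zC.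
  have [/= /[!in_itv]/= /andP[_ zx] /andP[_ zy]] := zC.
  rewrite -/(f1 h) -/(f2 h) in zx zy; rewrite zx zy !andbT.
  case: (boolP (rank_of f1 h < tx)%N) => r1 /=; rewrite ?orbT//.
  case: (boolP (rank_of f2 h < ty)%N) => r2 /=; rewrite ?orbT//.
  rewrite !orbF; apply/bigcupP; exists a => //.
  by rewrite !inE r1 r2 !andbT; apply/asboolP; split.
have cH : #|H|%:R <= G%:R + ((e + 1) + (e + 1)) :> R.
  have [s1 _] := S1D1; have [s2 _] := S2D2.
  apply: le_trans (lerD (lexx _) (lerD s1 s2)).
  rewrite -!natrD ler_nat; apply: leq_trans (subset_leq_card HU) _.
  apply: leq_trans (leq_card_setU _ _) _; apply: leq_add => //.
  exact: leq_card_setU.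
have := hits_near (inr (inord 3)); rewrite /test_set inordK//= -/e.
rewrite -[N _]/(#|H|%:R) ltr_norml => /andP[h1 h2].
have h3 : (tLIS k (restr_corner mu x y) - eps) * n%:R <=
    fine (mu (A `&` corner x y)) * n%:R.
  by rewrite ler_wpM2r// ltW.
rewrite mulrBl -/e in h3; rewrite mulrC; lra.
Qed.

(** The excess is [e + 1] for each strip, and [e] for each of the stray points, the count of the box
    and the error in [hj]. *)
Let upper : G%:R <= n%:R * tLIS k (restr_corner mu x y) + 5 * e + 2.
Proof.
(* The chains are random, but their cells form one of finitely many families, all tested in advance.
   Keeping only points of the corner puts the sets [B a] inside the unit square, as [hj]
   requires. *)
have [F [hF GE]] := greene_witness (point_rel z) k D.
pose B a : set (R * R) := [set p | exists2 h, h \in F a & p = z h /\ corner x y p].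
have ndB a : nondecreasing_set (B a).
  move=> _ _ [g gF [-> _]] [h hF' [-> _]].
  have [/chainP hc _] := hF a.
  have [->|gh] := eqVneq g h; first by rewrite subrr mul0r.
  case/orP: (hc _ _ gF hF' gh) => /andP[l1 l2].
    by rewrite mulr_ge0// subr_ge0 ltW.
  by rewrite mulr_le0// subr_le0 ltW.
have BU a : B a `<=` unit_square R.
  by move=> p [h _ [_ /corner_sub_unit_square]]; apply.
pose C0 := cells j (\bigcup_a B a).
set H := hits (box C0 `&` corner x y) z.
set O := hits (~` unit_square R) z.
have GU : (\bigcup_a F a)%SET \subset
    (H :|: ((D1 :\: S1) :|: (D2 :\: S2) :|: O))%SET.
  apply/fintype.subsetP => h /bigcupP[a _ hFa].
  have [_ /fintype.subsetP/(_ _ hFa)] := hF a.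
  rewrite !inE => /andP[-> ->]; rewrite !andbT -!ltNge.
  rewrite -/(f1 h) -/(f2 h).
  have [x1|] := leP (f1 h) x; last by rewrite !orbT.
  have [y1|] := leP (f2 h) y; last by rewrite !orbT.
  have [zU|zU] := pselect (unit_square R (z h)); last first.
    by rewrite (asboolT zU) !orbT.
  apply/orP; left; apply/asboolP.
  have zC : corner x y (z h).
    have [/= /[!in_itv]/= /andP[a1 _] /andP[a2 _]] := zU.
    by split=> /=; rewrite in_itv/= ?a1 ?a2.
  split=> //; apply: sub_box_cells; first by move=> p [b _ /BU].
  by exists a => //; exists h.
have cG : G%:R <= #|H|%:R + ((e + 1) + (e + 1) + #|O|%:R) :> R.
  have [_ s1] := S1D1; have [_ s2] := S2D2.
  apply: le_trans (lerD (lexx _) (lerD (lerD s1 s2) (lexx _))).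
  rewrite -!natrD ler_nat /G GE; apply: leq_trans (subset_leq_card GU) _.
  apply: leq_trans (leq_card_setU _ _) _; apply: leq_add => //.
  apply: leq_trans (leq_card_setU _ _) _; apply: leq_add => //.
  exact: leq_card_setU.
have cO : #|O|%:R <= e.
  have := hits_near (inr (inord 2)); rewrite /test_set inordK//= -/e.
  by rewrite permuton_unit_squareC// mul0r subr0 => /ltW/(le_trans (ler_norm _)).
have := hits_near (inl C0); rewrite /test_set /= -/e.
rewrite -[N _]/(#|H|%:R) ltr_norml => /andP[h1 h2].
have h3 : fine (mu (box C0 `&` corner x y)) * n%:R <=
    (tLIS k (restr_corner mu x y) + eps) * n%:R.
  by rewrite ler_wpM2r// hj.
rewrite mulrDl -/e in h3; rewrite mulrC; lra.
Qed.

Lemma LIS_tLIS_dist : 0 <= eps ->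
  `|(LIS k (subword s tx ty))%:R - n%:R * tLIS k (restr_corner mu x y)| <=
  5 * (eps * n%:R) + 2.
Proof.
move=> eps0; rewrite LIS_subword (greene_is_Perm k tx ty zs) -/D -/G -/e ler_norml.
have e0 : 0 <= e by rewrite mulr_ge0.
by move: lower upper => l u; apply/andP; split; lra.
Qed.

End Deterministic.

(** * Almost sure convergence *)

Section OrderPattern.
Variables (R : realType) (n : nat).
Implicit Types z : 'I_n -> plane R.

Definition coord_lt (i : 'I_n * 'I_n * bool) z : Prop :=
  if i.2 then (z i.1.1).1 < (z i.1.2).1 else (z i.1.1).2 < (z i.1.2).2.

Definition order_pattern z : {set 'I_n * 'I_n * bool} :=
  [set i | `[< coord_lt i z >]]%SET.

(** Ranks and distinctness depend only on finitely many strict comparisons of coordinates;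
    measurability of the event follows from this. *)
Lemma is_Perm_pattern z z' (t : 'S_n) :
  order_pattern z = order_pattern z' -> is_Perm z t -> is_Perm z' t.
Proof.
move=> E [x_inj y_inj ht].
have lt1 a b : ((z a).1 < (z b).1) = ((z' a).1 < (z' b).1).
  move/setP: E => /(_ (a, b, true)); rewrite !inE /coord_lt /=.
  by move=> E; apply/idP/idP => /asboolP; [rewrite E|rewrite -E] => /asboolP.
have lt2 a b : ((z a).2 < (z b).2) = ((z' a).2 < (z' b).2).
  move/setP: E => /(_ (a, b, false)); rewrite !inE /coord_lt /=.
  by move=> E; apply/idP/idP => /asboolP; [rewrite E|rewrite -E] => /asboolP.
have r1 h : rank_of (fun a => (z' a).1) h = rank_of (fun a => (z a).1) h.
  by congr (#|pred_of_set _|); apply/setP => a; rewrite !inE lt1.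
have r2 h : rank_of (fun a => (z' a).2) h = rank_of (fun a => (z a).2) h.
  by congr (#|pred_of_set _|); apply/setP => a; rewrite !inE lt2.
split=> [a b ab|a b ab|h i j].
- by apply: x_inj; apply/eqP; rewrite eq_le !leNgt !lt1 ab ltxx.
- by apply: y_inj; apply/eqP; rewrite eq_le !leNgt !lt2 ab ltxx.
- by rewrite r1 r2; exact: ht.
Qed.

Lemma measurable_is_Perm (d : measure_display) (T : measurableType d)
    (Z : 'I_n -> T -> plane R) (t : 'S_n) :
  (forall h, measurable_fun setT (Z h)) ->
  measurable [set w | is_Perm (fun h => Z h w) t].
Proof.
move=> mZ; pose Q (J : {set 'I_n * 'I_n * bool}) :=
  exists2 z, order_pattern z = J & is_Perm z t.
have -> : [set w | is_Perm (fun h => Z h w) t] =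
    [set w | Q (order_pattern (fun h => Z h w))].
  apply/seteqP; split=> [w /= wt|w /= [z zw]]; first by eexists; last exact: wt.
  exact: is_Perm_pattern.
apply: (@measurable_pattern _ _ _ (fun i => [set w | coord_lt i (fun h => Z h w)])).
move=> [[a b] [|]]; rewrite /coord_lt /=.
  have m1 h : measurable_fun setT (fun w => (Z h w).1).
    by apply: (measurableT_comp measurable_fst).
  have := measurable_fun_ltr (m1 a) (m1 b) measurableT
    (Logic.I : measurable [set true]).
  by rewrite setTI.
have m2 h : measurable_fun setT (fun w => (Z h w).2).
  by apply: (measurableT_comp measurable_snd).
have := measurable_fun_ltr (m2 a) (m2 b) measurableT (Logic.I : measurable [set true]).
by rewrite setTI.
Qed.

End OrderPattern.

(** * From the law of the permutation to an underlying sample *)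

Section Transfer.
Context {R : realType} {d : measure_display} {T : measurableType d}.
Variables (P : probability T R) (n : nat) (mu : probability (plane R) R).
Variable s : T -> 'S_n.
Hypothesis s_sample : is_sample P mu s.

Lemma measurable_sample_event (E : set 'S_n) : measurable [set w | E (s w)].
Proof.
have [ms _] := s_sample.
have -> : [set w | E (s w)] = \bigcup_(t in E) (s @^-1` [set t]).
  by apply/seteqP; split=> [w Ew|w [t Et /= wt]]; [exists (s w)|rewrite /= wt].
by apply: fin_bigcup_measurable => //; exact: finite_finset.
Qed.

(** Only the law of [s] matters, so the event moves to the space that carries the points, where a
    union bound over the test sets applies. *)
Lemma sample_event_bound (I : finType) (B : I -> set (plane R)) (eps : R)
    (E : set 'S_n) : (forall i, measurable (B i)) -> 0 < eps <= 1 ->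
  (forall z t, is_Perm z t -> E t -> exists i, deviates mu eps (B i) z) ->
  (P [set w | E (s w)] <=
   ((2 * #|I|%:R) * expR (- (eps ^+ 2 / 8)) ^+ n)%:E)%E.
Proof.
move=> mB eps01 hE; have [ms [d' [T' [P' [Z [hZ law]]]]]] := s_sample.
have [mZ _ _] := hZ.
have sE : [set w | E (s w)] = \bigcup_(t in E) (s @^-1` [set t]).
  by apply/seteqP; split=> [w Ew|w [t Et /= wt]]; [exists (s w)|rewrite /= wt].
have Efin : finite_set E by exact: finite_finset.
pose A t := [set w | is_Perm (fun h => Z h w) t].
have mA t : measurable (A t) by exact: measurable_is_Perm.
have -> : P [set w | E (s w)] = P' (\bigcup_(t in E) A t).
  rewrite sE !measure_fin_bigcup//.
  - by apply: eq_fsbigr => t _; exact: law.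
  - by move=> t u _ _ [w [/is_Perm_inj]]; apply.
  - by move=> t u _ _ [w [/= wt wu]]; rewrite -wt.
pose C i := [set w | deviates mu eps (B i) (fun h => Z h w)].
have mC i : measurable (C i) by exact: (measurable_deviates hZ).
apply: (@le_trans _ _ (P' (\bigcup_(i in [set` [pred i : I | true]]) C i))).
  apply: le_measure; rewrite ?inE.
  - exact: fin_bigcup_measurable.
  - by apply: fin_bigcup_measurable => //; exact: finite_finset.
  - move=> w [t Et wt]; have [i hi] := hE _ _ wt Et.
    by exists i.
apply: le_trans (measure_bigcup_fin_le P' [pred i | true] mC) _.
apply: (@le_trans _ _ (\sum_(i : I) (2 * expR (- (eps ^+ 2 / 8)) ^+ n)%:E)%E).
  by apply: lee_sum => i _; exact: hits_deviation.
rewrite sumEFin lee_fin sumr_const -[leLHS]mulr_natr.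
by rewrite mulrAC.
Qed.

End Transfer.

Section AlmostSure.
Context {R : realType} {d : measure_display} {T : measurableType d}.
Variables (P : probability T R).

Lemma geometric_Borel_Cantelli (A : nat -> set T) (c q : R) :
  (forall n, measurable (A n)) -> 0 <= c -> 0 <= q < 1 ->
  (forall n, (P (A n) <= (c * q ^+ n)%:E)%E) ->
  {ae P, forall w, \forall n \near \oo, ~ A n w}.
Proof.
move=> mA c0 /andP[q0 q1] hA.
have : P (lim_sup_set A) = 0.
  apply: lim_sup_set_cvg0 => //.
  apply: (@le_lt_trans _ _ (\big[+%E/0%R]_(0 <= n <oo) (c * q ^+ n)%:E)).
    by apply: lee_nneseries => n *; [exact: measure_ge0|exact: hA].
  have -> : (\big[+%E/0%R]_(0 <= n <oo) (c * q ^+ n)%:E)%E =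
      (limn (EFin \o series (geometric c q)))%E.
    by congr (limn _); apply/funext => n /=; rewrite sumEFin.
  rewrite EFin_lim ?ltry//; apply: is_cvg_geometric_series.
  by rewrite ger0_norm.
move=> PA0; exists (lim_sup_set A); split=> //.
  apply: bigcapT_measurable => n; exact: bigcup_measurable.
move=> w /= hw n _; apply: contrapT => hn; apply: hw.
exists n => // m nm Am; apply: hn; by exists m.
Qed.

End AlmostSure.

(** * Passage to the limit and uniformity from grids *)

Section RealLimits.
Variable R : realType.

Lemma near_natr_inv_lt (e : R) : 0 < e -> \forall n \near \oo, (n%:R : R)^-1 < e.
Proof.
move=> e0; exists (Num.truncn e^-1).+1 => // n /= hn.
have n0 : 0 < n%:R :> R by rewrite ltr0n; exact: leq_trans hn.
rewrite invf_plt ?posrE//; apply: lt_le_trans (truncnS_gt _) _.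
by rewrite ler_nat.
Qed.

(** The term [n%:R^-1] absorbs the truncation of [x * n] to an integer. *)
Lemma limit_le_add (u v : nat -> R) (a b c : R) :
  u n @[n --> \oo] --> a -> v n @[n --> \oo] --> b ->
  (forall n, (0 < n)%N -> v n <= u n + c + n%:R^-1) -> b <= a + c.
Proof.
move=> ua vb h; rewrite leNgt; apply/negP => lt.
pose e := (b - a - c) / 3; have e0 : 0 < e by rewrite /e; lra.
near \oo => n.
have h1 : `|a - u n| < e by near: n; apply: (cvgrPdist_lt _ _).1.
have h2 : `|b - v n| < e by near: n; apply: (cvgrPdist_lt _ _).1.
have h3 : n%:R^-1 < e by near: n; exact: near_natr_inv_lt.
have n0 : (0 < n)%N by near: n; exists 1%N.
have := h n n0; move: h1 h2 h3; rewrite !ltr_norml /e => /andP[? ?] /andP[? ?] ? ?.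
lra.
Unshelve. all: by end_near.
Qed.

Lemma grid_bracket (M : nat) (x : R) : x \in `[0, 1] ->
  exists a b : 'I_M.+2, [/\ a%:R / M.+1%:R <= x, x <= b%:R / M.+1%:R &
    b%:R / M.+1%:R <= a%:R / M.+1%:R + M.+1%:R^-1 :> R].
Proof.
rewrite in_itv/= => /andP[x0 x1].
have M0 : 0 < M.+1%:R :> R by rewrite ltr0n.
have xM0 : 0 <= x * M.+1%:R by rewrite mulr_ge0// ltW.
have /andP[h1 h2] := truncn_itv xM0; set a := Num.truncn _ in h1 h2.
have aM : (a < M.+2)%N.
  by rewrite ltnS -(@ler_nat R); apply: le_trans h1 _; rewrite ler_piMl// ltW.
(* The upper neighbour is capped at [M.+1], which matters only for [x = 1]. *)
have [b [bM ab xb]] : exists b : nat, [/\ (b < M.+2)%N, (b <= a.+1)%N &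
    x * M.+1%:R <= b%:R].
  have [aM'|Ma] := leqP a.+1 M.+1; first by exists a.+1; split=> //; exact: ltW.
  by exists M.+1; split=> //; [exact: ltnW|rewrite ler_piMl// ltW].
exists (Ordinal aM), (Ordinal bM); split=> /=.
- by rewrite ler_pdivrMr.
- by rewrite ler_pdivlMr.
- by rewrite -[X in _ + X]mul1r -mulrDl ler_pM2r ?invr_gt0// natr1 ler_nat.
Qed.

(* Monotonicity upgrades pointwise convergence on grids to uniform
   convergence, as in Dini's second theorem. *)
Lemma monotone_grid_uniform (u : nat -> R -> R -> R) (f : R -> R -> R) :
  (forall n x x' y, x \in `[0, 1] -> x' \in `[0, 1] -> y \in `[0, 1] -> x <= x' ->
     u n x y <= u n x' y) ->
  (forall n x y y', x \in `[0, 1] -> y \in `[0, 1] -> y' \in `[0, 1] -> y <= y' ->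
     u n x y <= u n x y') ->
  (forall x x' y, x \in `[0, 1] -> x' \in `[0, 1] -> y \in `[0, 1] -> x <= x' ->
     f x y <= f x' y <= f x y + (x' - x)) ->
  (forall x y y', x \in `[0, 1] -> y \in `[0, 1] -> y' \in `[0, 1] -> y <= y' ->
     f x y <= f x y' <= f x y + (y' - y)) ->
  (forall M a b : nat, (a <= M.+1)%N -> (b <= M.+1)%N ->
     u n (a%:R / M.+1%:R) (b%:R / M.+1%:R) @[n --> \oo] -->
     f (a%:R / M.+1%:R) (b%:R / M.+1%:R)) ->
  forall e : R, 0 < e -> \forall n \near \oo,
    forall x y : R, x \in `[0, 1] -> y \in `[0, 1] -> `|f x y - u n x y| < e.
Proof.
move=> u1 u2 f1 f2 cvg e e0.
(* Over one grid cell [f] varies by at most two mesh widths, less than [e / 2]; the other [e / 2] is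
   the error at grid points. *)
have [M hM] : exists M : nat, (M.+1%:R)^-1 < e / 4.
  have e4 : 0 < e / 4 by rewrite divr_gt0.
  have [N _ hN] := near_natr_inv_lt e4.
  by exists N; apply: hN => /=.
pose g (a : 'I_M.+2) : R := a%:R / M.+1%:R.
have M0 : 0 < M.+1%:R :> R by rewrite ltr0n.
have g01 a : g a \in `[0, 1].
  rewrite in_itv/= /g divr_ge0// ?(ltW M0)//= ler_pdivrMr// mul1r ler_nat.
  by rewrite -ltnS ltn_ord.
have near_grid : \forall n \near \oo, forall i : 'I_M.+2 * 'I_M.+2,
    `|f (g i.1) (g i.2) - u n (g i.1) (g i.2)| < e / 2.
  apply: filter_forall => -[a b] /=; apply: (cvgrPdist_lt _ _).1.
    by apply: cvg; rewrite -ltnS ltn_ord.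
  by rewrite divr_gt0.
apply: filterS near_grid => n hn x y x01 y01.
have [a [a' [xa xa' aa']]] : exists a a', [/\ g a <= x, x <= g a' &
  g a' <= g a + M.+1%:R^-1] := grid_bracket M x01.
have [b [b' [yb yb' bb']]] : exists b b', [/\ g b <= y, y <= g b' &
  g b' <= g b + M.+1%:R^-1] := grid_bracket M y01.
have := hn (a, b); have := hn (a', b').
rewrite /= !ltr_norml => /andP[p1 p2] /andP[q1 q2].
have ax := le_trans xa xa'; have bY := le_trans yb yb'.
have A1 := le_trans (u1 n _ _ _ (g01 a) x01 (g01 b) xa) (u2 n _ _ _ x01 (g01 b) y01 yb).
have A2 := le_trans (u1 n _ _ _ x01 (g01 a') y01 xa')
  (u2 n _ _ _ (g01 a') y01 (g01 b') yb').
have /andP[B1 _] := f1 _ _ _ (g01 a) x01 (g01 b) xa.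
have /andP[B2 _] := f2 _ _ _ x01 (g01 b) y01 yb.
have /andP[B3 _] := f1 _ _ _ x01 (g01 a') y01 xa'.
have /andP[B4 _] := f2 _ _ _ (g01 a') y01 (g01 b') yb'.
have /andP[_ B5] := f1 _ _ _ (g01 a) (g01 a') (g01 b) ax.
have /andP[_ B6] := f2 _ _ _ (g01 a') (g01 b) (g01 b') bY.
move: M.+1%:R^-1 hM aa' bb' => v hM aa' bb'.
clear - e0 hM aa' bb' p1 p2 q1 q2 A1 A2 B1 B2 B3 B4 B5 B6.
by apply/andP; split; lra.
Qed.

End RealLimits.

(** * Almost sure limits of the rescaled quantities *)

Section AlmostSureLimits.
Context {R : realType} {d : measure_display} {T : measurableType d}.
Variables (mu : probability (plane R) R) (P : probability T R).
Hypothesis hmu : permuton mu.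
Variable sigma : forall n : nat, T -> 'S_n.
Hypothesis hsigma : forall n : nat, (0 < n)%N -> is_sample P mu (sigma n).

Definition scaled_LIS k n (s : 'S_n) (x y : R) : R :=
  n%:R^-1 * (LIS k (subword s (Num.truncn (x * n%:R)) (Num.truncn (y * n%:R))))%:R.

Definition scaled_lam k n (s : 'S_n) (x y : R) : R :=
  n%:R^-1 * lam R k s (Num.truncn (x * n%:R)) (Num.truncn (y * n%:R)).

Lemma scaled_LIS_near k x y (e : R) : x \in `[0, 1] -> y \in `[0, 1] -> 0 < e <= 1 ->
  {ae P, forall w, \forall n \near \oo,
    `|tLIS k (restr_corner mu x y) - scaled_LIS k (sigma n w) x y| <= 6 * e}.
Proof.
move=> x01 y01 e01; have /andP[e0 e1] := e01.
have [A hA hAe] := tLIS_adherent mu x y k e0.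
have [j hj] := box_cells_tLIS mu x01 y01 k e0.
set L := tLIS k (restr_corner mu x y).
pose bad n : set 'S_n := [set t | 5 * (e * n%:R) + 2 <
  `|(LIS k (subword t (Num.truncn (x * n%:R)) (Num.truncn (y * n%:R))))%:R - n%:R * L|].
pose I : finType := ({set cell_index j} + 'I_4)%type.
pose c : R := 2 * #|I|%:R; pose q : R := expR (- (e ^+ 2 / 8)).
have q01 : 0 <= q < 1.
  by rewrite expR_ge0 expR_lt1 oppr_lt0 divr_gt0// exprn_gt0.
have c0 : 0 <= c * q by rewrite !mulr_ge0// expR_ge0.
(* The sampling hypothesis starts at size 1, so the index is shifted and the constant becomes
   [c * q]. *)
have key := @geometric_Borel_Cantelli R d T P
  (fun n => [set w | bad n.+1 (sigma n.+1 w)]) (c * q) q _ c0 q01 _.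
apply: filterS (key _ _) => [w [N _ hN]|n|n]; first 1 last.
- exact: (measurable_sample_event (hsigma (ltn0Sn n))).
- rewrite -mulrA -exprS; apply: (sample_event_bound (hsigma (ltn0Sn n)) _ e01).
    by move=> i; exact: (measurable_test_set x y hA i).
  move=> z t zt; apply: contraPP => /forallNP hdev.
  rewrite /bad /=; apply/negP; rewrite -leNgt.
  exact: (LIS_tLIS_dist hmu x01 y01 hA hAe hj zt hdev (ltW e0)).
(* This turns the additive 2 of the deterministic bound into the sixth [e] after division by [n]. *)
have [M _ hM] : \forall n \near \oo, (n%:R : R)^-1 < e / 2.
  by apply: near_natr_inv_lt; rewrite divr_gt0.
exists (maxn N.+1 M) => // n /=; rewrite geq_max => /andP[nN nM].
case: n nN nM => [//|n] nN nM.
have /negP := hN n nN; rewrite -leNgt => hn.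
have {hM} := hM _ nM; have n0 : 0 < n.+1%:R :> R by rewrite ltr0n.
rewrite -(ltr_pM2r n0) mulVf ?gt_eqF// => hM.
rewrite -(ler_pM2r n0) -[X in _ * X <= _]gtr0_norm// -normrM mulrBl /scaled_LIS.
rewrite mulrAC mulVf ?gt_eqF// mul1r distrC [L * _]mulrC.
apply: le_trans hn _; lra.
Qed.

Lemma scaled_LIS_cvg k x y : x \in `[0, 1] -> y \in `[0, 1] ->
  {ae P, forall w, scaled_LIS k (sigma n w) x y @[n --> \oo] -->
    tLIS k (restr_corner mu x y)}.
Proof.
move=> x01 y01.
have : \forall w \ae P, forall m : nat, \forall n \near \oo,
    `|tLIS k (restr_corner mu x y) - scaled_LIS k (sigma n w) x y| <=
    6 * m.+1%:R^-1.
  apply: ae_foralln => m; apply: scaled_LIS_near => //.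
  by rewrite invr_gt0 ltr0n/= invf_le1 ?ltr0n// ler1n.
apply: filterS => w hw; apply/cvgrPdist_lt => e e0.
have e6 : 0 < e / 6 by rewrite divr_gt0.
have [m _ hm] := near_natr_inv_lt e6.
apply: filterS (hw m) => n /le_lt_trans; apply.
rewrite mulrC -ltr_pdivlMr//; exact: (hm m.+1 (leqnSn m)).
Qed.

Lemma scaled_lam_cvg k x y : x \in `[0, 1] -> y \in `[0, 1] ->
  {ae P, forall w, scaled_lam k (sigma n w) x y @[n --> \oo] --> tlam mu k x y}.
Proof.
move=> x01 y01; have h1 := scaled_LIS_cvg k x01 y01.
have h2 := scaled_LIS_cvg k.-1 x01 y01.
apply: filterS2 h1 h2 => w h1 h2.
rewrite (_ : (fun n => _) = (fun n => scaled_LIS k (sigma n w) x y -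
    scaled_LIS k.-1 (sigma n w) x y)); first exact: cvgB.
by apply/funext => n; rewrite /scaled_lam /lam mulrBr.
Qed.

Lemma truncn_incr n (x x' : R) : (0 < n)%N -> 0 <= x -> x <= x' ->
  n%:R^-1 * ((Num.truncn (x' * n%:R))%:R - (Num.truncn (x * n%:R))%:R) <=
  (x' - x) + n%:R^-1.
Proof.
move=> n_gt0 x0 xx'; have n0 : 0 < n%:R :> R by rewrite ltr0n.
have /andP[_ h1] := truncn_itv (mulr_ge0 x0 (ltW n0)).
have /andP[h2 _] := truncn_itv (mulr_ge0 (le_trans x0 xx') (ltW n0)).
rewrite -(ler_pM2l n0) mulrA mulfV ?gt_eqF// mul1r mulrDr mulfV ?gt_eqF//.
by move: h1; rewrite -natr1 mulrBr; rewrite (mulrC x) in h2 *; lra.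
Qed.

Lemma scaled_lam_incrl k n (s : 'S_n) x x' y : (0 < k)%N -> 0 <= x -> x <= x' ->
  scaled_lam k s x y <= scaled_lam k s x' y /\
  ((0 < n)%N -> scaled_lam k s x' y <= scaled_lam k s x y + (x' - x) + n%:R^-1).
Proof.
move=> k0 x0 xx'.
have tt' : (Num.truncn (x * n%:R) <= Num.truncn (x' * n%:R))%N.
  by apply: le_truncn; rewrite ler_wpM2r.
have /andP[h1 h2] := @lam_incrl R n s k _ _ (Num.truncn (y * n%:R)) k0 tt'.
split; first by rewrite ler_wpM2l// invr_ge0.
move=> n0; apply: le_trans (ler_wpM2l _ h2) _; first by rewrite invr_ge0.
by rewrite mulrDr -addrA lerD2l; exact: truncn_incr.
Qed.

Lemma scaled_lam_incrr k n (s : 'S_n) x y y' : (0 < k)%N -> 0 <= y -> y <= y' ->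
  scaled_lam k s x y <= scaled_lam k s x y' /\
  ((0 < n)%N -> scaled_lam k s x y' <= scaled_lam k s x y + (y' - y) + n%:R^-1).
Proof.
move=> k0 y0 yy'.
have tt' : (Num.truncn (y * n%:R) <= Num.truncn (y' * n%:R))%N.
  by apply: le_truncn; rewrite ler_wpM2r.
have /andP[h1 h2] := @lam_incrr R n s k (Num.truncn (x * n%:R)) _ _ k0 tt'.
split; first by rewrite ler_wpM2l// invr_ge0.
move=> n0; apply: le_trans (ler_wpM2l _ h2) _; first by rewrite invr_ge0.
by rewrite mulrDr -addrA lerD2l; exact: truncn_incr.
Qed.

(** A probability is not zero, so an almost sure property has a witness; this is how deterministic
    facts about [tlam] are drawn from random permutations. *)
Let ae_proper : ProperFilter (almost_everywhere P).
Proof.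
apply: ae_properfilter_algebraOfSetsType.
by rewrite [ltRHS](@probability_setT _ _ _ P).
Qed.

Lemma tlam_incrl k x x' y : (0 < k)%N ->
  x \in `[0, 1] -> x' \in `[0, 1] -> y \in `[0, 1] -> x <= x' ->
  tlam mu k x y <= tlam mu k x' y <= tlam mu k x y + (x' - x).
Proof.
move=> k0 x01 x01' y01 xx'.
have x0 : 0 <= x by move: x01; rewrite in_itv/= => /andP[].
have : \forall w \ae P, scaled_lam k (sigma n w) x y @[n --> \oo] --> tlam mu k x y
    /\ scaled_lam k (sigma n w) x' y @[n --> \oo] --> tlam mu k x' y.
  by apply: filterI; exact: scaled_lam_cvg.
move=> /(@filter_ex _ _ ae_proper)[w [h1 h2]]; apply/andP; split.
  rewrite -[leRHS]addr0; apply: limit_le_add h2 h1 _ => n n0; rewrite addr0.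
  have [le1 _] := scaled_lam_incrl (sigma n w) y k0 x0 xx'.
  by apply: le_trans le1 _; rewrite lerDl invr_ge0.
apply: limit_le_add h1 h2 _ => n n0.
by have [_] := scaled_lam_incrl (sigma n w) y k0 x0 xx'; apply.
Qed.

Lemma tlam_incrr k x y y' : (0 < k)%N ->
  x \in `[0, 1] -> y \in `[0, 1] -> y' \in `[0, 1] -> y <= y' ->
  tlam mu k x y <= tlam mu k x y' <= tlam mu k x y + (y' - y).
Proof.
move=> k0 x01 y01 y01' yy'.
have y0 : 0 <= y by move: y01; rewrite in_itv/= => /andP[].
have : \forall w \ae P, scaled_lam k (sigma n w) x y @[n --> \oo] --> tlam mu k x y
    /\ scaled_lam k (sigma n w) x y' @[n --> \oo] --> tlam mu k x y'.
  by apply: filterI; exact: scaled_lam_cvg.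
move=> /(@filter_ex _ _ ae_proper)[w [h1 h2]]; apply/andP; split.
  rewrite -[leRHS]addr0; apply: limit_le_add h2 h1 _ => n n0; rewrite addr0.
  have [le1 _] := scaled_lam_incrr (sigma n w) x k0 y0 yy'.
  by apply: le_trans le1 _; rewrite lerDl invr_ge0.
apply: limit_le_add h1 h2 _ => n n0.
by have [_] := scaled_lam_incrr (sigma n w) x k0 y0 yy'; apply.
Qed.

(** All grids together contain countably many points, so one null set serves them all, and
    uniformity is then proved outcome by outcome. *)
Lemma scaled_lam_uniform k : (0 < k)%N ->
  {ae P, forall w, forall e : R, 0 < e -> \forall n \near \oo,
    forall x y, x \in `[0, 1] -> y \in `[0, 1] ->
      `|tlam mu k x y - scaled_lam k (sigma n w) x y| < e}.
Proof.
move=> k0.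
have : \forall w \ae P, forall M a b : nat, (a <= M.+1)%N -> (b <= M.+1)%N ->
    scaled_lam k (sigma n w) (a%:R / M.+1%:R) (b%:R / M.+1%:R) @[n --> \oo] -->
    tlam mu k (a%:R / M.+1%:R) (b%:R / M.+1%:R).
  apply: ae_foralln => M; apply: ae_foralln => a; apply: ae_foralln => b.
  have [aM|aM] := leqP a M.+1; last by apply: aeW => w.
  have [bM|bM] := leqP b M.+1; last by apply: aeW => w.
  have g01 (i : nat) : (i <= M.+1)%N -> i%:R / M.+1%:R \in `[0, (1 : R)].
    move=> iM; rewrite in_itv/= divr_ge0//= ler_pdivrMr ?ltr0n// mul1r.
    by rewrite ler_nat.
  by apply: filterS (scaled_lam_cvg k (g01 _ aM) (g01 _ bM)) => w h _ _.
apply: filterS => w hw; apply: monotone_grid_uniform hw.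
- move=> n x x' y; rewrite in_itv/= => /andP[x0 _] _ _ xx'.
  by have [] := scaled_lam_incrl (sigma n w) y k0 x0 xx'.
- move=> n x y y' _; rewrite in_itv/= => /andP[y0 _] _ yy'.
  by have [] := scaled_lam_incrr (sigma n w) x k0 y0 yy'.
- by move=> x x' y; exact: tlam_incrl.
- by move=> x y y'; exact: tlam_incrr.
Qed.

End AlmostSureLimits.

Lemma monotone_lipschitz1 (R : realType) (f : R -> R) :
  (forall x x', x \in `[0, 1] -> x' \in `[0, 1] -> x <= x' ->
     f x <= f x' <= f x + (x' - x)) ->
  {in `[0, 1] &, {homo f : x x' / x <= x'}} /\ 1.-lipschitz_(`[0, 1]%classic) f.
Proof.
move=> hf; split=> [x x' x01 x01' xx'|].
  by have /andP[] := hf x x' x01 x01' xx'.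
move=> [x x'] /= [x01 x01']; rewrite mul1r.
have [xx'|/ltW xx'] := leP x x'.
  have /andP[h1 h2] := hf _ _ x01 x01' xx'.
  by rewrite distrC [leRHS]distrC !ger0_norm ?subr_ge0//; lra.
have /andP[h1 h2] := hf _ _ x01' x01 xx'.
by rewrite !ger0_norm ?subr_ge0//; lra.
Qed.

Theorem proposition2p9 (R : realType) (mu : probability (plane R) R)
    (hmu : permuton mu)
    (d : measure_display) (T : measurableType d) (P : probability T R)
    (sigma : forall n : nat, T -> 'S_n)
    (hsigma : forall n : nat, (0 < n)%N -> is_sample P mu (sigma n))
    (k : nat) (hk : (0 < k)%N) :
  [/\ (forall y : R, y \in `[0, 1] ->
         {in `[0, 1] &, {homo (fun x => tlam mu k x y) : x x' / x <= x'}} /\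
         1.-lipschitz_(`[0, 1]%classic) (fun x : R => tlam mu k x y)),
      (forall x : R, x \in `[0, 1] ->
         {in `[0, 1] &, {homo (fun y => tlam mu k x y) : y y' / y <= y'}} /\
         1.-lipschitz_(`[0, 1]%classic) (fun y : R => tlam mu k x y)) &
      {ae P, forall w : T,
         {uniform (unit_square R),
           (fun (n : nat) (z : R * R) =>
              n%:R^-1 * lam R k (sigma n w) (Num.truncn (z.1 * n%:R))
                                            (Num.truncn (z.2 * n%:R))) @ \oo
           --> (fun z : R * R => tlam mu k z.1 z.2)}}].
Proof.
split.
- move=> y y01; apply: monotone_lipschitz1 => x x' x01 x01' xx'.
  exact: (tlam_incrl hmu hsigma).
- move=> x x01; apply: monotone_lipschitz1 => y y' y01 y01' yy'.
  exact: (tlam_incrr hmu hsigma).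
- apply: filterS (scaled_lam_uniform hmu hsigma hk) => w hw.
  move=> Q /uniform_nbhs[E [entE EQ]].
  move: entE; rewrite -entourage_ballE => -[e /= e0 eE].
  apply: filterS (hw e e0) => n hn; apply: EQ => z [z1 z2]; apply: eE.
  exact: hn.
Qed.
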